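(* Let $\varepsilon\in(0,3]$ be a real number. Let $p$ be a prime and $m \ge 1$ an integer. Let $\lambda_0, \lambda_1, \ldots, \lambda_m \in \mathbb{Z}$ with $\lambda_i \neq 0$ for some $i$, and let $\alpha_1, \ldots, \alpha_m \in \mathbb{Q}$ be pairwise distinct and non-zero. Let $Q>0$ be an integer such that $Q\alpha_i\in\mathbb{Z}$ for all $i=1,\ldots,m$. Assume that $M>1$, $\alpha<1$, $H>1$, $f(m,M,Q,\alpha)>1$, and $$-\frac{1}{e^{R_1(m,M,Q,\alpha)}H} = \frac{-\log f(m,M,Q,\alpha)}{2^{m-1} e^{1.03883m} Q^m H \cdot \frac{M^{m+1}}{M-1} \cdot (m+1)(m+2) \alpha} \ge -\frac{1}{e}.$$ Suppose also that $$\frac{(m+1)\log\alpha}{\log f(m,M,Q,\alpha)}\ge -m-1-\frac{\varepsilon}{3}$$ and $$H\ge\max\left\{\left(c_1(m,M,Q,\alpha)\right)^{-3/\varepsilon},\ \frac12 e^{-\left(3m/\varepsilon+1\right)W_{-1}\left(-2^{-\varepsilon/(3m+\varepsilon)}\frac{\varepsilon}{3m+\varepsilon}\right)}\right\}.$$ Then $$|\Lambda_p|_p>H^{-m-1-\varepsilon}.$$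
   Context: $|\cdot|_p$ is the $p$-adic absolute value (with $|p|_p=1/p$), $|\cdot|$ the usual absolute value. $\boldsymbol{\log}$ denotes the $p$-adic logarithm, $\boldsymbol{\log}(1+t)=\sum_{n=0}^\infty \frac{(-1)^n}{n+1}t^{n+1}$, which converges $p$-adically for $|t|_p<1$; non-bold $\log$ is the real natural logarithm. $\Lambda_p := \lambda_0+\lambda_1\boldsymbol{\log}(1+\alpha_1)+\ldots+\lambda_m\boldsymbol{\log}(1+\alpha_m)$, $M:=\max_{1\le i\le m}|\alpha_i|$, $\alpha:=\max_{1\le i\le m}|\alpha_i|_p$, $H:=\max_{0\le i\le m}|\lambda_i|$. $$f(m,M,Q,\alpha):=2^{-1}\cdot 3^{-m}e^{-1.03883m}Q^{-m}M^{-m}\alpha^{-m-1}.$$ \begin{multline*}R_1(m,M,Q,\alpha):=1.03883m+m\log Q+\log(m+1)+(m-1)\log 2+(m+1)\log M\\-\log(M-1)+\log(m+2)+\log\alpha-\log\log f(m,M,Q,\alpha),\end{multline*} $$c_1(m,M,Q,\alpha):=\frac{M-1}{6^m(m+1)e^{2.07766m}Q^{2m}M^{2m+1}}\cdot e^{\left(\frac{(m+1)\log\alpha}{\log f(m,M,Q,\alpha)}+1\right)\left(R_1(m,M,Q,\alpha)+1\right)}.$$ $W_{-1}$ is the branch of the Lambert $W$ function defined on $[-1/e,0)$: for $x\in[-1/e,0)$, $W_{-1}(x)$ is the unique real $w\le -1$ with $we^w=x$. *)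

(* Defs.v *)
From HB Require Import structures.
From mathcomp Require Import all_boot all_order all_algebra.
From mathcomp Require Import all_classical all_reals all_analysis.
From mathcomp Require Import generic_quotient ring_quotient zify ring lra.

Set Implicit Arguments.
Unset Strict Implicit.
Unset Printing Implicit Defensive.

Import Order.TTheory GRing.Theory Num.Theory.
Import numFieldNormedType.Exports.
Local Open Scope classical_set_scope.
Local Open Scope ring_scope.
Local Open Scope quotient_scope.

Definition padic_abs (p : nat) (x : rat) : rat :=
  if x == 0 then 0 else
  p%:R ^ ((logn p `|denq x|)%:Z - (logn p `|numq x|)%:Z).

Section PadicAbs.
Variables (p : nat) (hp : prime p).

Implicit Types x y : rat.

Let p_gt0 : 0 < p%:R :> rat. Proof. by rewrite ltr0n prime_gt0. Qed.
Let p_neq0 : p%:R != 0 :> rat. Proof. by rewrite gt_eqF. Qed.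

Lemma padic_abs0 : padic_abs p 0 = 0.
Proof. by rewrite /padic_abs eqxx. Qed.

Lemma padic_abs_gt0 x : x != 0 -> 0 < padic_abs p x.
Proof. by rewrite /padic_abs => /negbTE ->; rewrite exprz_gt0. Qed.

Lemma padic_abs_ge0 x : 0 <= padic_abs p x.
Proof.
by have [->|/padic_abs_gt0/ltW//] := eqVneq x 0; rewrite padic_abs0.
Qed.

Lemma padic_abs_eq0 x : (padic_abs p x == 0) = (x == 0).
Proof.
have [->|x0] := eqVneq x 0; first by rewrite padic_abs0 eqxx.
by rewrite gt_eqF// padic_abs_gt0.
Qed.

Lemma padic_absN x : padic_abs p (- x) = padic_abs p x.
Proof. by rewrite /padic_abs oppr_eq0 numqN denqN abszN. Qed.

Lemma padic_abs_frac (n d : int) : n != 0 -> d != 0 ->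
  padic_abs p (n%:~R / d%:~R) = p%:R ^ ((logn p `|d|)%:Z - (logn p `|n|)%:Z).
Proof.
move=> n0 d0; set x := _ / _.
have x0 : x != 0 by rewrite mulf_neq0 ?invr_eq0 ?intr_eq0.
have E : n * denq x = numq x * d.
  apply: (intr_inj (R := rat)); rewrite !intrM numqE /x.
  by rewrite mulrAC mulfVK ?intr_eq0.
have := congr1 (fun z : int => logn p `|z|%N) E.
rewrite !abszM !lognM ?absz_gt0 ?numq_eq0// => El.
rewrite /padic_abs (negbTE x0); congr (_ ^ _).
by move: El; lia.
Qed.

Lemma padic_absM x y : padic_abs p (x * y) = padic_abs p x * padic_abs p y.
Proof.
have [->|x0] := eqVneq x 0; first by rewrite mul0r padic_abs0 mul0r.
have [->|y0] := eqVneq y 0; first by rewrite mulr0 padic_abs0 mulr0.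
rewrite -[in LHS](divq_num_den x) -[in LHS](divq_num_den y).
rewrite mulrACA -invfM -!intrM padic_abs_frac ?mulf_neq0 ?numq_eq0//.
rewrite /padic_abs (negbTE x0) (negbTE y0) -expfzDr//; congr (_ ^ _).
rewrite !abszM !lognM ?absz_gt0 ?numq_eq0// !PoszD opprD.
exact: addrACA.
Qed.

Lemma padic_abs1 : padic_abs p 1 = 1.
Proof. by rewrite /padic_abs oner_eq0 logn1 subrr. Qed.

Lemma padic_absV x : padic_abs p x^-1 = (padic_abs p x)^-1.
Proof.
have [->|x0] := eqVneq x 0; first by rewrite invr0 padic_abs0.
apply: (@mulfI _ (padic_abs p x)); first by rewrite padic_abs_eq0.
by rewrite -padic_absM !divff ?padic_abs_eq0// padic_abs1.
Qed.

Lemma padic_abs_ultra x y :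
  padic_abs p (x + y) <= Num.max (padic_abs p x) (padic_abs p y).
Proof.
have [->|x0] := eqVneq x 0; first by rewrite add0r le_max lexx orbT.
have [->|y0] := eqVneq y 0; first by rewrite addr0 le_max lexx.
have [->|xy0] := eqVneq (x + y) 0.
  by rewrite padic_abs0 le_max padic_abs_ge0.
have p1 : 1 < p%:R :> rat by rewrite ltr1n prime_gt1.
have Ex : x = (numq x * denq y)%:~R / (denq x * denq y)%:~R.
  by rewrite !intrM numqE -(mulrA x) mulfK// mulf_neq0// intr_eq0.
have Ey : y = (numq y * denq x)%:~R / (denq x * denq y)%:~R.
  by rewrite !intrM numqE -(mulrA y) [(denq y)%:~R * _]mulrC mulfK// mulf_neq0// intr_eq0.
set a := numq x * denq y in Ex; set b := numq y * denq x in Ey.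
set d := denq x * denq y in Ex Ey.
have a0 : a != 0 by rewrite mulf_neq0// numq_eq0.
have b0 : b != 0 by rewrite mulf_neq0// numq_eq0.
have d0 : d != 0 by rewrite mulf_neq0.
have Exy : x + y = (a + b)%:~R / d%:~R by rewrite Ex Ey -mulrDl intrD.
have ab0 : a + b != 0.
  by apply: contra xy0 => /eqP ab0; rewrite Exy ab0 mul0r.
rewrite Exy [in leRHS]Ex [in leRHS]Ey !padic_abs_frac// le_max.
rewrite !ler_eXz2l// !lerD2l !lerN2 !lez_nat -geq_min.
rewrite -pfactor_dvdn ?absz_gt0//.
set k := minn _ _.
have pa : (p ^ k %| `|a|)%N.
  by rewrite pfactor_dvdn ?absz_gt0// geq_minl.
have pb : (p ^ k %| `|b|)%N.
  by rewrite pfactor_dvdn ?absz_gt0// geq_minr.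
have : ((p ^ k)%N%:Z %| a + b)%Z by apply: rpredD.
by [].
Qed.

Lemma padic_abs_isosceles x y : padic_abs p (x - y) < padic_abs p y ->
  padic_abs p x = padic_abs p y.
Proof.
move=> xy; apply/eqP; rewrite eq_le; apply/andP; split.
  have := padic_abs_ultra (x - y) y; rewrite subrK => /le_trans; apply.
  by rewrite ge_max lexx ltW.
have := padic_abs_ultra (y - x) x; rewrite subrK le_max => /orP[|//].
by rewrite -opprB padic_absN leNgt xy.
Qed.

End PadicAbs.

Definition padic_null (p : nat) (u : nat -> rat) : Prop :=
  forall e : rat, 0 < e ->
    exists N, forall n, (N <= n)%N -> padic_abs p (u n) < e.

(* The primality proof is an argument because the ring structure needs it. *)
Definition padic_cauchy (p : nat) (_ : prime p) : {pred nat -> rat} := fun u =>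
  `[< forall e : rat, 0 < e -> exists N, forall i j,
        (N <= i)%N -> (N <= j)%N -> padic_abs p (u i - u j) < e >].

Section Qp.
Variables (p : nat) (hp : prime p).

Lemma padic_abs_ltD (e x y : rat) :
  padic_abs p x < e -> padic_abs p y < e -> padic_abs p (x + y) < e.
Proof.
by move=> xe ye; apply: le_lt_trans (padic_abs_ultra hp x y) _; rewrite gt_max xe ye.
Qed.

Lemma padic_cauchy_bounded u : u \in padic_cauchy hp ->
  exists2 B : rat, 0 < B & forall n, padic_abs p (u n) < B.
Proof.
move=> /asboolP /(_ 1 ltr01)[N HN].
exists (1 + \sum_(i < N.+1) padic_abs p (u i)).
  by rewrite ltr_pwDl// sumr_ge0// => i _; exact: padic_abs_ge0.
have le_sum i : (i < N.+1)%N ->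
    padic_abs p (u i) <= \sum_(i < N.+1) padic_abs p (u i).
  move=> iN; rewrite (bigD1 (Ordinal iN))//= lerDl sumr_ge0// => j _.
  exact: padic_abs_ge0.
move=> n; have [nN|nN] := ltnP n N.+1.
  by apply: le_lt_trans (le_sum _ nN) _; rewrite ltrDr.
rewrite -(subrK (u N) (u n)); apply: padic_abs_ltD.
  apply: lt_le_trans (HN n N (ltnW nN) (leqnn _)) _.
  by rewrite lerDl sumr_ge0// => i _; exact: padic_abs_ge0.
by apply: le_lt_trans (le_sum N (leqnn _)) _; rewrite ltrDr.
Qed.

Lemma padic_cauchy_subring_closed : subring_closed (padic_cauchy hp).
Proof.
split.
- apply/asboolP => e e0; exists 0%N => i j _ _.
  by rewrite (_ : (1 : nat -> rat) = cst 1)// subrr padic_abs0.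
- move=> u v /asboolP hu /asboolP hv; apply/asboolP => e e0.
  have [N HN] := hu e e0; have [M HM] := hv e e0.
  exists (maxn N M) => i j; rewrite !geq_max => /andP[Ni Mi] /andP[Nj Mj].
  rewrite (_ : (u - v) i - (u - v) j = (u i - u j) + - (v i - v j)).
    by apply: padic_abs_ltD; [exact: HN|rewrite padic_absN; exact: HM].
  by rewrite -[(u - v) i]/(u i - v i) -[(u - v) j]/(u j - v j); ring.
- move=> u v cu cv; have [A A0 HA] := padic_cauchy_bounded cu.
  have [B B0 HB] := padic_cauchy_bounded cv.
  move: cu cv => /asboolP hu /asboolP hv; apply/asboolP => e e0.
  have [N HN] := hu (e / B) (divr_gt0 e0 B0).
  have [M HM] := hv (e / A) (divr_gt0 e0 A0).
  exists (maxn N M) => i j; rewrite !geq_max => /andP[Ni Mi] /andP[Nj Mj].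
  rewrite (_ : (u * v) i - (u * v) j = (u i - u j) * v i + u j * (v i - v j)).
    apply: padic_abs_ltD; rewrite padic_absM//.
      have [->|h] := eqVneq (padic_abs p (v i)) 0; first by rewrite mulr0.
      have h0 : 0 < padic_abs p (v i) by rewrite lt_def h padic_abs_ge0.
      rewrite -ltr_pdivlMr//; apply: lt_le_trans (HN _ _ Ni Nj) _.
      by rewrite ler_pM2l// lef_pV2 ?posrE// ltW.
    have [->|h] := eqVneq (padic_abs p (u j)) 0; first by rewrite mul0r.
    have h0 : 0 < padic_abs p (u j) by rewrite lt_def h padic_abs_ge0.
    rewrite mulrC -ltr_pdivlMr//; apply: lt_le_trans (HM _ _ Mi Mj) _.
    by rewrite ler_pM2l// lef_pV2 ?posrE// ltW.
  by rewrite -[(u * v) i]/(u i * v i) -[(u * v) j]/(u j * v j); ring.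
Qed.

HB.instance Definition _ :=
  GRing.isSubringClosed.Build (nat -> rat) (padic_cauchy hp)
    padic_cauchy_subring_closed.

Record cauchy_seq := CauchySeq {
  cauchy_val :> nat -> rat;
  cauchy_valP : cauchy_val \in padic_cauchy hp }.

HB.instance Definition _ := [isSub for cauchy_val].
HB.instance Definition _ := [Choice of cauchy_seq by <:].
HB.instance Definition _ := [SubChoice_isSubComNzRing of cauchy_seq by <:].

Lemma cauchy_valB (u v : cauchy_seq) n : (u - v) n = u n - v n.
Proof. by []. Qed.
Lemma cauchy_valD (u v : cauchy_seq) n : (u + v) n = u n + v n.
Proof. by []. Qed.
Lemma cauchy_valM (u v : cauchy_seq) n : (u * v) n = u n * v n.
Proof. by []. Qed.

Lemma cauchy_seqP (u : cauchy_seq) (e : rat) : 0 < e -> exists N, forall i j,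
  (N <= i)%N -> (N <= j)%N -> padic_abs p (u i - u j) < e.
Proof. by case: u => u /= /asboolP; apply. Qed.

Definition null_seq : {pred cauchy_seq} := fun u => `[< padic_null p u >].

Lemma null_seq_ideal : idealr_closed null_seq.
Proof.
split.
- by apply/asboolP => e e0; exists 0%N => n _; rewrite padic_abs0.
- apply/negP => /asboolP /(_ 1 ltr01)[N /(_ N (leqnn _))].
  by rewrite padic_abs1 ltxx.
- move=> a u v /asboolP hu /asboolP hv; apply/asboolP => e e0.
  have [B B0 HB] := padic_cauchy_bounded (cauchy_valP a).
  have [N HN] := hu (e / B) (divr_gt0 e0 B0); have [M HM] := hv e e0.
  exists (maxn N M) => n; rewrite geq_max => /andP[Nn Mn].
  rewrite cauchy_valD cauchy_valM; apply: padic_abs_ltD; last exact: HM.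
  rewrite padic_absM//.
  have [->|h] := eqVneq (padic_abs p (a n)) 0; first by rewrite mul0r.
  have h0 : 0 < padic_abs p (a n) by rewrite lt_def h padic_abs_ge0.
  rewrite mulrC -ltr_pdivlMr//; apply: lt_le_trans (HN _ Nn) _.
  by rewrite ler_pM2l// lef_pV2 ?posrE// ltW.
Qed.

HB.instance Definition _ :=
  isIdealr.Build cauchy_seq null_seq null_seq_ideal.

(* Q_p as the completion of the rationals for the p-adic absolute value. *)
Definition Qp : Type := {ideal_quot null_seq}.

HB.instance Definition _ := GRing.ComNzRing.on Qp.
HB.instance Definition _ := EqQuotient.on Qp.

End Qp.

Section QpAbs.
Variables (p : nat) (hp : prime p).
Implicit Types (x y z : Qp hp) (u v : cauchy_seq hp).

(* |x|_p is the limit of |x_n|_p along any Cauchy sequence representing x. *)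
Definition Qp_abs x : rat :=
  limn (fun n => padic_abs p (repr x n) : rat^o).

Lemma Qp_eq0 u : (\pi_(Qp hp) u == 0) = (u \in null_seq (hp:=hp)).
Proof.
by rewrite -(rmorph0 \pi_{ideal_quot (null_seq (hp:=hp))}) -Quotient.idealrBE subr0.
Qed.

Lemma Qp_eqP u v : reflect (padic_null p (u \- v)) (\pi_(Qp hp) u == \pi_(Qp hp) v).
Proof. by rewrite -Quotient.idealrBE; exact: asboolP. Qed.

Lemma cauchy_abs_const u : u \notin null_seq (hp:=hp) ->
  exists2 c : rat, 0 < c &
    exists N, forall n, (N <= n)%N -> padic_abs p (u n) = c.
Proof.
move=> /asboolPn hu.
have [e e0 He] : exists2 e : rat, 0 < e &
    forall N, exists2 n, (N <= n)%N & e <= padic_abs p (u n).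
  apply: contrapT => h; apply: hu => e e0; apply: contrapT => h1; apply: h.
  exists e => // N; apply: contrapT => h2; apply: h1; exists N => n Nn.
  by rewrite ltNge; apply/negP => h3; apply: h2; exists n.
have [N HN] := cauchy_seqP u e0; have [k Nk ek] := He N.
exists (padic_abs p (u k)); first exact: lt_le_trans ek.
exists N => n Nn; apply: padic_abs_isosceles => //.
by apply: lt_le_trans ek; exact: HN.
Qed.

Lemma Qp_abs0 : Qp_abs 0 = 0.
Proof.
rewrite /Qp_abs; apply: (@cvg_lim rat^o (@norm_hausdorff _ _)).
have : repr (0 : Qp hp) \in null_seq (hp:=hp) by rewrite -Qp_eq0 reprK.
move=> /asboolP h0; apply/cvgrPdist_lt => e e0; have [N HN] := h0 e e0.
exists N => // n /= Nn; rewrite sub0r normrN ger0_norm ?padic_abs_ge0//.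
exact: HN.
Qed.

Lemma Qp_abs_const u : u \notin null_seq (hp:=hp) ->
  exists N, forall n, (N <= n)%N ->
    padic_abs p (u n) = Qp_abs (\pi_(Qp hp) u).
Proof.
move=> /cauchy_abs_const[c c0 [N HN]]; suff -> : Qp_abs (\pi_(Qp hp) u) = c.
  by exists N.
rewrite /Qp_abs; apply: (@cvg_lim rat^o (@norm_hausdorff _ _)).
have : padic_null p (repr (\pi_(Qp hp) u) \- u) by apply/Qp_eqP; rewrite reprK.
move=> /(_ c c0)[M HM]; apply/cvgrPdist_lt => e e0.
exists (maxn N M) => // n /=; rewrite geq_max => /andP[Nn Mn].
rewrite (@padic_abs_isosceles p hp _ (u n)) ?HN// ?subrr ?normr0//.
exact: HM.
Qed.

Lemma Qp_abs_repr x : x != 0 -> exists N, forall n, (N <= n)%N ->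
  padic_abs p (repr x n) = Qp_abs x.
Proof.
by rewrite -{1}[x]reprK Qp_eq0 => /Qp_abs_const; rewrite reprK.
Qed.

Lemma Qp_abs_gt0 x : x != 0 -> 0 < Qp_abs x.
Proof.
rewrite -{1}[x]reprK Qp_eq0 => hx; have [c c0 [N HN]] := cauchy_abs_const hx.
have [M] := Qp_abs_const hx; rewrite reprK => HM.
by rewrite -(HM (maxn N M)) ?leq_maxr// HN ?leq_maxl.
Qed.

Lemma Qp_abs_eq0 x : (Qp_abs x == 0) = (x == 0).
Proof.
by have [->|/Qp_abs_gt0/gt_eqF//] := eqVneq x 0; rewrite Qp_abs0 eqxx.
Qed.

Lemma Qp_abs_ge0 x : 0 <= Qp_abs x.
Proof. by have [->|/Qp_abs_gt0/ltW//] := eqVneq x 0; rewrite Qp_abs0. Qed.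

Lemma Qp_piD u v : \pi_(Qp hp) (u + v) = \pi_(Qp hp) u + \pi_(Qp hp) v.
Proof. exact: (rmorphD \pi_{ideal_quot (null_seq (hp:=hp))}). Qed.

Lemma Qp_piM u v : \pi_(Qp hp) (u * v) = \pi_(Qp hp) u * \pi_(Qp hp) v.
Proof. exact: (rmorphM \pi_{ideal_quot (null_seq (hp:=hp))}). Qed.

Lemma Qp_piN u : \pi_(Qp hp) (- u) = - \pi_(Qp hp) u.
Proof. exact: (rmorphN \pi_{ideal_quot (null_seq (hp:=hp))}). Qed.

Lemma Qp_pi1 : \pi_(Qp hp) 1 = 1.
Proof. exact: (rmorph1 \pi_{ideal_quot (null_seq (hp:=hp))}). Qed.

Lemma Qp_absN x : Qp_abs (- x) = Qp_abs x.
Proof.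
have [->|x0] := eqVneq x 0; first by rewrite oppr0.
have h : - repr x \notin null_seq (hp:=hp).
  by rewrite -Qp_eq0 Qp_piN reprK oppr_eq0.
have [N HN] := Qp_abs_const h; have [M HM] := Qp_abs_repr x0.
have := HN (maxn N M) (leq_maxl _ _); rewrite Qp_piN reprK => <-.
by rewrite -(HM _ (leq_maxr N M)) -[RHS]padic_absN.
Qed.

Lemma Qp_absM x y : Qp_abs (x * y) = Qp_abs x * Qp_abs y.
Proof.
have [->|x0] := eqVneq x 0; first by rewrite mul0r Qp_abs0 mul0r.
have [->|y0] := eqVneq y 0; first by rewrite mulr0 Qp_abs0 mulr0.
have [N HN] := Qp_abs_repr x0; have [M HM] := Qp_abs_repr y0.
have EM n : (maxn N M <= n)%N ->
    padic_abs p ((repr x * repr y) n) = Qp_abs x * Qp_abs y.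
  rewrite geq_max => /andP[Nn Mn].
  by rewrite cauchy_valM padic_absM// HN// HM.
have h : repr x * repr y \notin null_seq (hp:=hp).
  apply/asboolPn => /(_ _ (mulr_gt0 (Qp_abs_gt0 x0) (Qp_abs_gt0 y0))).
  move=> [K /(_ (maxn K (maxn N M)) (leq_maxl _ _))].
  by rewrite EM ?leq_maxr// ltxx.
have [K HK] := Qp_abs_const h.
have := HK (maxn K (maxn N M)) (leq_maxl _ _).
by rewrite EM ?leq_maxr// Qp_piM !reprK => ->.
Qed.

Lemma Qp_abs_ultra x y : Qp_abs (x + y) <= Num.max (Qp_abs x) (Qp_abs y).
Proof.
have [->|x0] := eqVneq x 0; first by rewrite add0r le_max lexx orbT.
have [->|y0] := eqVneq y 0; first by rewrite addr0 le_max lexx.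
have [->|xy0] := eqVneq (x + y) 0.
  by rewrite Qp_abs0 le_max Qp_abs_ge0.
have [N HN] := Qp_abs_repr x0; have [M HM] := Qp_abs_repr y0.
have h : repr x + repr y \notin null_seq (hp:=hp).
  by rewrite -Qp_eq0 Qp_piD !reprK.
have [K] := Qp_abs_const h; rewrite Qp_piD !reprK => HK.
rewrite -(HK (maxn K (maxn N M))) ?leq_maxl//.
rewrite -(HN (maxn K (maxn N M))); last lia.
rewrite -(HM (maxn K (maxn N M))); last lia.
by rewrite cauchy_valD padic_abs_ultra.
Qed.

Definition Qp_inv x : Qp hp :=
  if x == 0 then 0 else
  \pi_(Qp hp) (insubd (0 : cauchy_seq hp) (fun n => (repr x n)^-1)).

Lemma cauchy_inv u : u \notin null_seq (hp:=hp) ->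
  (fun n => (u n)^-1) \in padic_cauchy hp.
Proof.
move=> /cauchy_abs_const[c c0 [N HN]]; apply/asboolP => e e0.
have [M HM] := cauchy_seqP u (mulr_gt0 e0 (mulr_gt0 c0 c0)).
exists (maxn N M) => i j; rewrite !geq_max => /andP[Ni Mi] /andP[Nj Mj].
have u0 n : (N <= n)%N -> u n != 0.
  by move=> /HN h; rewrite -(padic_abs_eq0 hp) h gt_eqF.
have -> : (u i)^-1 - (u j)^-1 = (u j - u i) * ((u i)^-1 * (u j)^-1).
  by field; rewrite !u0.
rewrite !padic_absM// !padic_absV// !HN// -invfM ltr_pdivrMr ?mulr_gt0//.
exact: HM.
Qed.

Lemma Qp_mulVf x : x != 0 -> Qp_inv x * x = 1.
Proof.
move=> x0; rewrite /Qp_inv (negbTE x0); set v := insubd _ _.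
have h : repr x \notin null_seq (hp:=hp) by rewrite -Qp_eq0 reprK.
have vE n : v n = (repr x n)^-1 by rewrite /v insubdK// cauchy_inv.
rewrite -{1}[x]reprK -Qp_piM -Qp_pi1; apply/eqP/Qp_eqP => e e0.
have [c c0 [N HN]] := cauchy_abs_const h.
exists N => n Nn; rewrite -[X in padic_abs _ X]/(v n * repr x n - 1) vE mulVf.
  by rewrite subrr padic_abs0.
by rewrite -(padic_abs_eq0 hp) HN// gt_eqF.
Qed.

Lemma Qp_inv0 : Qp_inv 0 = 0. Proof. by rewrite /Qp_inv eqxx. Qed.

HB.instance Definition _ :=
  GRing.ComNzRing_isField.Build (Qp hp) Qp_mulVf Qp_inv0.

(* The ball radii are rational, which defines the same topology as real ones. *)
Definition Qp_ball x (e : rat) : set (Qp hp) := [set y | Qp_abs (x - y) < e].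
Definition Qp_ent : set_system (Qp hp * Qp hp) := entourage_ Qp_ball.
Definition Qp_nbhs x : set_system (Qp hp) := nbhs_ Qp_ent x.

Lemma Qp_nbhsE : Qp_nbhs = nbhs_ Qp_ent. Proof. by []. Qed.

Lemma Qp_ball_center x (e : rat) : 0 < e -> Qp_ball x e x.
Proof. by rewrite /Qp_ball /= subrr Qp_abs0. Qed.

Lemma Qp_ball_sym x y (e : rat) : Qp_ball x e y -> Qp_ball y e x.
Proof. by rewrite /Qp_ball /= -opprB Qp_absN. Qed.

Lemma Qp_ball_triangle x y z (e1 e2 : rat) :
  Qp_ball x e1 y -> Qp_ball y e2 z -> Qp_ball x (e1 + e2) z.
Proof.
rewrite /Qp_ball /= => h1 h2; rewrite -(subrK y x) -addrA.
apply: le_lt_trans (Qp_abs_ultra _ _) _.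
have := Qp_abs_ge0 (x - y); have := Qp_abs_ge0 (y - z).
by rewrite gt_max => ? ?; apply/andP; split; lra.
Qed.

Lemma Qp_entE : Qp_ent = entourage_ Qp_ball. Proof. by []. Qed.

HB.instance Definition _ := isPointed.Build (Qp hp) 0.
HB.instance Definition _ := hasNbhs.Build (Qp hp) Qp_nbhs.
HB.instance Definition _ := @Nbhs_isPseudoMetric.Build rat (Qp hp)
  Qp_ent Qp_nbhsE Qp_ball Qp_ball_center Qp_ball_sym Qp_ball_triangle Qp_entE.

Lemma Qp_hausdorff : hausdorff_space (Qp hp).
Proof.
rewrite ball_hausdorff => x y xy.
have d0 : 0 < Qp_abs (x - y) by rewrite Qp_abs_gt0// subr_eq0.
exists (PosNum d0, PosNum d0); apply/eqP/seteqP; split => // z [] /=.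
rewrite /ball /= /Qp_ball /= => h1 h2.
have := Qp_abs_ultra (x - z) (z - y); rewrite addrA subrK le_max.
by rewrite leNgt h1 /= leNgt -(opprB y z) Qp_absN h2.
Qed.

Lemma Qp_cvgP (s : nat -> Qp hp) x : s @ \oo --> x <->
  forall e : rat, 0 < e -> exists N, forall n, (N <= n)%N -> Qp_abs (x - s n) < e.
Proof.
split=> [/cvg_ballP h e e0|h].
  by have [N _ HN] := h e e0; exists N => n Nn; exact: (HN n Nn).
by apply/cvg_ballP => e e0; have [N HN] := h e e0; exists N => // n /= /HN.
Qed.

Lemma cst_cauchy (q : rat) : cst q \in padic_cauchy hp.
Proof. by apply/asboolP => e e0; exists 0%N => i j _ _; rewrite subrr padic_abs0. Qed.

Let cauchy_cst (q : rat) : cauchy_seq hp := CauchySeq (cst_cauchy q).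

Lemma ratr_Qp (q : rat) :
  ratr q = \pi_(Qp hp) (CauchySeq (cst_cauchy q)) :> Qp hp.
Proof.
have nN (n : nat) : n%:R = \pi_(Qp hp) (cauchy_cst n%:R).
  elim: n => [|n IH].
    apply/esym/eqP; rewrite Qp_eq0; apply/asboolP => e e0.
    by exists 0%N => n _; rewrite /= padic_abs0.
  by rewrite -addn1 natrD IH -Qp_pi1 -Qp_piD; congr (\pi _); apply: val_inj; rewrite /= natrD.
have zN (n : int) : n%:~R = \pi_(Qp hp) (cauchy_cst n%:~R).
  case: n => n; first exact: nN.
  rewrite NegzE mulrNz -[in LHS]pmulrn nN -Qp_piN; congr (\pi _); apply: val_inj.
  by rewrite /= mulrNz.
have d0 : (denq q)%:~R != 0 :> Qp hp.
  rewrite zN Qp_eq0; apply/asboolPn.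
  have e0 : 0 < padic_abs p (denq q)%:~R by rewrite padic_abs_gt0// intr_eq0.
  by move=> /(_ _ e0)[N /(_ N (leqnn _))]; rewrite /= ltxx.
rewrite /ratr; apply: (mulIf d0); rewrite mulfVK// !zN -Qp_piM.
by congr (\pi _); apply: val_inj; rewrite /= numqE.
Qed.

Lemma Qp_abs_ratr (q : rat) : Qp_abs (ratr q) = padic_abs p q.
Proof.
have [q0|q0] := eqVneq q 0.
  rewrite /ratr (_ : numq q = 0); last by apply/eqP; rewrite numq_eq0 q0.
  by rewrite mulr0z mul0r Qp_abs0 q0 padic_abs0.
rewrite ratr_Qp.
have h : cauchy_cst q \notin null_seq (hp:=hp).
  apply/asboolPn; have e0 := padic_abs_gt0 hp q0.
  by move=> /(_ _ e0)[N /(_ N (leqnn _))]; rewrite /= ltxx.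
by have [N /(_ N (leqnn _))] := Qp_abs_const h.
Qed.

Lemma Qp_cvg_pi u : (fun n => ratr (u n) : Qp hp) @ \oo --> \pi_(Qp hp) u.
Proof.
apply/Qp_cvgP => e e0; have [N HN] := cauchy_seqP u e0; exists N => n Nn.
rewrite ratr_Qp -Qp_piN -Qp_piD.
set v := u + _; have [h|h] := boolP (v \in null_seq (hp:=hp)).
  by move: h; rewrite -Qp_eq0 => /eqP ->; rewrite Qp_abs0.
have [M /(_ (maxn N M) (leq_maxr _ _)) <-] := Qp_abs_const h.
by apply: HN => //; exact: leq_maxl.
Qed.

End QpAbs.

(* Here x = 1 + t, and the series is sum_n (-1)^n / (n+1) * t^(n+1). *)
Definition Qp_log (p : nat) (hp : prime p) (x : Qp hp) : Qp hp :=
  limn (series (fun n => (-1) ^+ n / n.+1%:R * (x - 1) ^+ n.+1)).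

Definition Lambda_p (p : nat) (hp : prime p) (m : nat)
    (lambda : 'I_m.+1 -> int) (alpha : 'I_m -> rat) : Qp hp :=
  (lambda ord0)%:~R +
  \sum_(i < m) (lambda (lift ord0 i))%:~R * Qp_log (1 + ratr (alpha i)).
Arguments Lambda_p {p} hp {m} lambda alpha.

Section Bounds.
Variable R : realType.

(* Starting the maxima at 0 is harmless: the entries are nonnegative, and
   the ranges are nonempty when m >= 1. *)
Definition max_abs (m : nat) (alpha : 'I_m -> rat) : R :=
  \big[Num.max/0]_(i < m) ratr `|alpha i|.

Definition max_padic_abs (p m : nat) (alpha : 'I_m -> rat) : R :=
  \big[Num.max/0]_(i < m) ratr (padic_abs p (alpha i)).

Definition max_coef (m : nat) (lambda : 'I_m.+1 -> int) : R :=
  \big[Num.max/0]_(i < m.+1) `|lambda i|%:~R.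

(* 1.03883 *)
Definition kappa : R := 103883%:R / 100000%:R.

Definition f (m : nat) (M Q a : R) : R :=
  2^-1 * 3 ^- m * expR (- (kappa * m%:R)) * Q ^- m * M ^- m * a ^- m.+1.

Definition R1 (m : nat) (M Q a : R) : R :=
  kappa * m%:R + m%:R * ln Q + ln (m%:R + 1) + (m%:R - 1) * ln 2
  + (m%:R + 1) * ln M - ln (M - 1) + ln (m%:R + 2) + ln a
  - ln (ln (f m M Q a)).

Definition c1 (m : nat) (M Q a : R) : R :=
  (M - 1) /
    (6 ^+ m * (m%:R + 1) * expR (207766%:R / 100000%:R * m%:R) * Q ^+ (2 * m)
      * M ^+ (2 * m).+1)
  * expR (((m%:R + 1) * ln a / ln (f m M Q a) + 1) * (R1 m M Q a + 1)).

(* The branch W_{-1}; meaningful for -1/e <= x < 0. *)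
Definition lambertWm1 (x : R) : R :=
  xget 0 [set w : R | w <= -1 /\ w * expR w = x].

(* The two closed forms of -1/(e^R1 H) always agree; m.-1 is m - 1 as m >= 1. *)
Lemma R1_identity (m : nat) (M Q a H : R) :
  (0 < m)%N -> 1 < M -> 0 < Q -> 0 < a -> 1 < f m M Q a ->
  - (1 / (expR (R1 m M Q a) * H)) =
  - ln (f m M Q a) /
    (2 ^+ m.-1 * expR (kappa * m%:R) * Q ^+ m * H * (M ^+ m.+1 / (M - 1))
     * ((m%:R + 1) * (m%:R + 2) * a)).
Proof.
case: m => // m _ M1 Q0 a0 f1; rewrite mulNr div1r; congr (- _).
have L0 : 0 < ln (f m.+1 M Q a) by rewrite ln_gt0.
have M0 : 0 < M by rewrite (lt_trans _ M1).
have M10 : 0 < M - 1 by rewrite subr_gt0.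
have n0 k : (0 : R) < m.+1%:R + k%:R by rewrite -natrD ltr0n.
have expRln (n : nat) (x : R) : 0 < x -> expR (n%:R * ln x) = x ^+ n.
  by move=> x0; rewrite mulrC expRM_natr lnK.
rewrite /R1 !(expRD, expRN) expRln// (_ : m.+1%:R - 1 = m%:R); last first.
  by rewrite -addn1 natrD addrK.
rewrite (_ : m.+1%:R + 1 = m.+2%:R); last by rewrite -[in RHS]addn1 natrD.
rewrite !expRln// !lnK ?posrE ?(n0 2%N)//.
rewrite /=; move: (_ ^+ _) (_ ^+ _) (_ ^+ _) (expR _) => A B C E.
move: (M - 1) (ln _) (m.+2%:R) (m.+1%:R + 2) => D L N2 N3.
rewrite !invfM !invrK; ring.
Qed.

End Bounds.

(* Main.v *)
(* Put b_i = - alpha_i and I_b(P) = \int_0^b P, so that log(1 + alpha_i) is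
   - I_(b_i)(1/(1 - x)) expanded p-adically.  For l <= m the polynomial
     A = 1/n! (d/dx)^n [x^l x^n \prod_i (x - b_i)^n]
   is orthogonal to 1, ..., x^(n-1) for every I_(b_i), so, with
   B = (A - A(1))/(x - 1),
     A(1) I_(b_i)(1/(1 - x)) - I_(b_i)(B) = \sum_(k >= n) I_(b_i)(x^k A),
   which is p-adically at most y a^y with y = (m + 1) n + 1.  The vectors
   (A(1), I_(b_1)(B), ..., I_(b_m)(B)) for l = 0, ..., m are independent: a
   dependency gives a polynomial of too small degree orthogonal to 1, ..., x^n.
   Hence some l makes the form lambda_0 A(1) - \sum_i lambda_i I_(b_i)(B)
   nonzero.  Multiplied by lcm(1, ..., N) Q^N with N = l + m n it is a nonzero
   integer, so its p-adic absolute value is at least the inverse of its size,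
   and the bound passes to Lambda_p as soon as the remainder is smaller.

   The elementary estimate lcm(1, ..., N) <= 4^N is enough, although 1.03883 is
   less than ln 4: the loss is absorbed by the bound H^(-eps/3) <= c_1 together
   with the fact that the hypothesis on (m + 1) log alpha / log f forces log f
   to be at least of order m^2/eps.  In the same way the condition on H involving
   W_(-1) is a consequence of the other ones. *)
From HB Require Import structures.
Require Import Defs.
From mathcomp Require Import all_boot all_order all_algebra.
From mathcomp Require Import all_classical all_reals all_analysis.
From mathcomp Require Import generic_quotient ring_quotient zify ring lra.

Set Implicit Arguments.
Unset Strict Implicit.
Unset Printing Implicit Defensive.

Import Order.TTheory GRing.Theory Num.Theory.
Import numFieldNormedType.Exports.
Local Open Scope ring_scope.

(** * The least common multiple of 1, ..., n *)

Definition lcm_upto (n : nat) : nat := \big[lcmn/1%N]_(i < n) i.+1.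

Lemma lcm_upto_gt0 n : (0 < lcm_upto n)%N.
Proof.
apply: (big_ind (fun d => (0 < d)%N)) => // a b a0 b0.
by rewrite lcmn_gt0 a0.
Qed.

Lemma dvdn_lcm_upto n i : (0 < i <= n)%N -> (i %| lcm_upto n)%N.
Proof.
case: i => // i /andP[_ lt_in].
exact: (biglcmn_sup (Ordinal lt_in)).
Qed.

Lemma lcm_uptoP n d :
  (forall i, (0 < i <= n)%N -> (i %| d)%N) -> (lcm_upto n %| d)%N.
Proof. by move=> h; apply/dvdn_biglcmP => i _; apply: h => /=. Qed.

Lemma lcm_upto_mono k n : (k <= n)%N -> (lcm_upto k %| lcm_upto n)%N.
Proof. by move=> kn; apply: lcm_uptoP => i ik; apply: dvdn_lcm_upto; lia. Qed.

Lemma int_divP (a b : nat) : (0 < b)%N ->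
  (a%:R / b%:R \is a @Num.int rat) = (b %| a)%N.
Proof.
move=> b0; have nz : b%:R != 0 :> rat by rewrite pnatr_eq0 -lt0n.
apply/idP/idP => [/intrP[z]|/dvdnP[c ->]]; last by rewrite natrM mulfK.
move=> /(canRL (divfK nz)).
move=> E; have {}E : a%:Z = z * b%:Z.
  by apply: (@intr_inj rat); rewrite intrM; exact: E.
have : (b%:Z %| a%:Z)%Z by rewrite E dvdz_mull.
by [].
Qed.

(* Leibniz' harmonic triangle writes 1 / (j 'C(n, j)) as an integral
   combination of 1, 1/2, ..., 1/n. *)
Lemma mul_bin_dvd_lcm_upto n j :
  (0 < j <= n)%N -> (j * 'C(n, j) %| lcm_upto n)%N.
Proof.
case: j => // k /andP[_ lt_kn]; rewrite -int_divP ?muln_gt0 ?bin_gt0//.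
elim: k n lt_kn => [|k IH] n lt_kn.
  by rewrite mul1n bin1 int_divP ?dvdn_lcm_upto//; lia.
case: n lt_kn => // n lt_kn.
have h1 : (lcm_upto n.+1)%:R / (k.+1 * 'C(n, k.+1))%:R \is a @Num.int rat.
  rewrite int_divP ?muln_gt0 ?bin_gt0//.
  apply: dvdn_trans (lcm_upto_mono (leqnSn n)).
  by rewrite -int_divP ?muln_gt0 ?bin_gt0// IH.
have h2 := IH n.+1 (ltnW lt_kn).
suff -> : (lcm_upto n.+1)%:R / (k.+2 * 'C(n.+1, k.+2))%:R =
    (lcm_upto n.+1)%:R / (k.+1 * 'C(n, k.+1))%:R -
    (lcm_upto n.+1)%:R / (k.+1 * 'C(n.+1, k.+1))%:R :> rat by apply: rpredB.
rewrite -(mul_bin_diag n.+1 k.+1) -(mul_bin_diag n.+1 k) !natrM -mulrBr; congr (_ * _).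
have n0 j : j.+1%:R != 0 :> rat by rewrite pnatr_eq0.
have c0 j : (j <= n)%N -> 'C(n, j)%:R != 0 :> rat.
  by move=> jn; rewrite pnatr_eq0 -lt0n bin_gt0.
have E : n.+1%:R * 'C(n, k)%:R =
    k.+1%:R * ('C(n, k.+1)%:R + 'C(n, k)%:R) :> rat.
  by rewrite -natrM (mul_bin_diag n.+1) binS natrM natrD.
move: E (c0 k.+1 lt_kn) (c0 k (ltnW (lt_kn : (k < n)%N))) (n0 n) (n0 k).
move: 'C(n, k.+1)%:R 'C(n, k)%:R n.+1%:R k.+1%:R => u v s t E u0 v0 s0 t0.
have -> : (t * u)^-1 - (s * v)^-1 = (s * v - t * u) / (t * u * (s * v)).
  by field; rewrite u0 v0 s0 t0.
have -> : s * v - t * u = t * v by rewrite E; ring.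
by field; rewrite u0 v0 s0 t0.
Qed.

(** [j * 'C(n, j)] already divides the lcm, and its product with ['C(y + n, n)] equals ['C(y + j -
    1, j - 1) * 'C(y + n, n - j) * (y + j)]. *)
Lemma dvdn_lcm_upto_bin y n j :
  (0 < j <= n)%N -> (y + j %| lcm_upto n * 'C(y + n, n))%N.
Proof.
move=> jn; have /dvdnP[q ->] := mul_bin_dvd_lcm_upto jn.
suff -> : (q * (j * 'C(n, j)) * 'C(y + n, n) =
    q * 'C(y + j.-1, j.-1) * 'C(y + n, n - j) * (y + j))%N.
  exact: dvdn_mull.
have B1 : ('C(n, j) * (j`! * (n - j)`!) = n`!)%N by apply: bin_fact; lia.
have B2 : ('C(y + n, n) * (n`! * (y + n - n)`!) = (y + n)`!)%N.
  by apply: bin_fact; lia.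
have B3 : ('C(y + j.-1, j.-1) * (j.-1`! * (y + j.-1 - j.-1)`!) = (y + j.-1)`!)%N.
  by apply: bin_fact; lia.
have B4 : ('C(y + n, n - j) * ((n - j)`! * (y + n - (n - j))`!) = (y + n)`!)%N.
  by apply: bin_fact; lia.
move: B1 B2 B3 B4; rewrite !addnK (_ : y + n - (n - j) = (y + j.-1).+1)%N; last lia.
rewrite factS => B1 B2 B3 B4.
have fj : (j`! = j * j.-1`!)%N by case: j jn {B1 B3 B4} => // j; rewrite factS.
rewrite -B1 fj in B2; rewrite -B3 -B2 in B4.
have yj : (y + j = (y + j.-1).+1)%N by lia.
rewrite yj.
have p0 : (0 < (n - j)`! * j.-1`! * y`!)%N by rewrite !muln_gt0 !fact_gt0.
suff E : (j * 'C(n, j) * 'C(y + n, n) =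
    'C(y + j.-1, j.-1) * 'C(y + n, n - j) * (y + j.-1).+1)%N.
  by rewrite -mulnA E !mulnA.
by apply/eqP; rewrite -(eqn_pmul2r p0); apply/eqP; lia.
Qed.

Lemma lcm_upto_addn y n : (n <= y)%N ->
  (lcm_upto (y + n) %| lcm_upto y * 'C(y + n, n))%N.
Proof.
move=> ny; apply: lcm_uptoP => i /andP[i0 iyn].
have [iy|yi] := leqP i y; first by rewrite dvdn_mulr// dvdn_lcm_upto// i0.
rewrite -(subnKC (ltnW yi)).
apply: dvdn_trans (dvdn_lcm_upto_bin y (_ : 0 < i - y <= n)%N) _; first lia.
by rewrite dvdn_mul// lcm_upto_mono.
Qed.

(** The factor 2 saved over the trivial bound is what the odd case of [lcm_upto_le_exp4] needs. *)
Lemma leq_binS_exp2 n k : ('C(n.+1, k) <= 2 ^ n)%N.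
Proof.
elim: n k => [|n IH] [|k]; rewrite ?bin0 ?expn_gt0//.
  by case: k => [|k]; rewrite ?bin1 ?bin_small.
by rewrite binS expnS mul2n -addnn leq_add.
Qed.

Lemma leq_bin_exp2 n k : ('C(n, k) <= 2 ^ n)%N.
Proof.
case: n => [|n]; first by case: k.
by apply: leq_trans (leq_binS_exp2 _ _) _; rewrite leq_exp2l.
Qed.

Lemma lcm_upto_le_exp4 n : (lcm_upto n <= 4 ^ n)%N.
Proof.
elim/ltn_ind: n => n IH.
have [n1|n1] := leqP n 1.
  case: n n1 {IH} => [|[|//]] _; rewrite /lcm_upto ?big_ord0//.
  by rewrite big_ord_recl big_ord0.
have En : n = (uphalf n + n./2)%N by rewrite uphalf_half; lia.
have yk : uphalf n = n./2 \/ uphalf n = (n./2).+1 by rewrite uphalf_half; lia.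
rewrite {1}En [in (4 ^ _)%N]En; move: (uphalf n) (n./2) En yk => y k En yk.
have /dvdn_leq := @lcm_upto_addn y k ltac:(lia).
rewrite muln_gt0 lcm_upto_gt0 bin_gt0 leq_addl => /(_ isT) /leq_trans; apply.
rewrite expnD leq_mul ?IH//; first lia.
rewrite -[4%N]/(2 ^ 2)%N -expnM; case: k En yk => [|k] En yk; first by rewrite bin0.
have -> : (y + k.+1 = (y + k).+1)%N by lia.
(* Here [y] is at most [k.+2], so the exponent [y + k] does not exceed [2 * k.+1]. *)
by apply: leq_trans (leq_binS_exp2 _ _) _; apply: leq_pexp2l => //; lia.
Qed.

(** * Formal integration of polynomials *)

Section Antiderivative.
Variable F : numFieldType.
Implicit Types (p q u : {poly F}) (b : F).

(* At index 0 the coefficient is a division by 0, hence 0. *)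
Definition antideriv p : {poly F} :=
  \poly_(i < (size p).+1) (p`_i.-1 / i%:R).

Lemma coef_antideriv p i : (antideriv p)`_i = p`_i.-1 / i%:R.
Proof.
rewrite coef_poly ltnS; case: leqP => // h.
by rewrite nth_default ?mul0r//; case: i h.
Qed.

Fact antideriv_is_linear : linear antideriv.
Proof.
move=> c p q; apply/polyP => i.
by rewrite coefD coefZ !coef_antideriv coefD coefZ mulrDl mulrA.
Qed.

HB.instance Definition _ :=
  GRing.isLinear.Build F {poly F} {poly F} _ antideriv antideriv_is_linear.

Lemma deriv_antideriv p : (antideriv p)^`() = p.
Proof.
apply/polyP => i; rewrite coef_deriv coef_antideriv /= -[LHS]mulr_natr mulfVK ?pnatr_eq0//.
Qed.

Lemma antideriv_horner0 p : (antideriv p).[0] = 0.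
Proof. by rewrite horner_coef0 coef_antideriv invr0 mulr0. Qed.

Lemma deriv0_const p : p^`() = 0 -> p = (p`_0)%:P.
Proof.
move=> h; apply/polyP => -[|i]; rewrite coefC//=.
have /eqP := coef_deriv p i; rewrite h coef0 eq_sym mulrn_eq0/= => /eqP ->.
by [].
Qed.

Lemma antideriv_deriv p : antideriv p^`() = p - (p.[0])%:P.
Proof.
rewrite horner_coef0; apply/eqP; rewrite -subr_eq0; apply/eqP.
set d := _ - _; have h : d^`() = 0.
  by rewrite !derivB deriv_antideriv derivC subr0 subrr.
rewrite (deriv0_const h) -horner_coef0 !hornerE antideriv_horner0.
by rewrite horner_coef0 subrr subr0.
Qed.

Lemma size_antideriv p : (size (antideriv p) <= (size p).+1)%N.
Proof. exact: size_poly. Qed.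

Definition integ b p : F := (antideriv p).[b].

Lemma integ_is_linear b : linear_for *%R (integ b).
Proof. by move=> c p q; rewrite /integ linearP hornerD hornerZ. Qed.

HB.instance Definition _ b :=
  GRing.isLinear.Build F {poly F} F _ (integ b) (integ_is_linear b).

Lemma integXn b k : integ b 'X^k = b ^+ k.+1 / k.+1%:R.
Proof.
rewrite /integ (_ : antideriv _ = k.+1%:R^-1 *: 'X^(k.+1)).
  by rewrite hornerZ hornerXn mulrC.
apply/polyP => i; rewrite coef_antideriv coefZ !coefXn.
case: i => [|i]; first by rewrite invr0 mulr0 mulr0.
by rewrite eqSS /=; case: eqP => [->|]; rewrite ?mul1r ?mulr1 ?mul0r ?mulr0.
Qed.

Lemma integ_deriv b p : integ b p^`() = p.[b] - p.[0].
Proof. by rewrite /integ antideriv_deriv !hornerE. Qed.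

Lemma integ_by_parts b k p : integ b ('X^(k.+1) * p^`()) =
  b ^+ k.+1 * p.[b] - k.+1%:R * integ b ('X^k * p).
Proof.
have : integ b ('X^(k.+1) * p)^`() = b ^+ k.+1 * p.[b].
  by rewrite integ_deriv !hornerE expr0n mul0r subr0.
rewrite derivM derivXn /= linearD/= => <-.
by rewrite mulrnAl linearMn/= mulr_natl addrAC subrr add0r.
Qed.

(** Each integration by parts lowers both the power of ['X] and the order of the derivative; all
    boundary terms vanish. *)
Lemma integ_ort_derivn b n k p : (k < n)%N ->
  (forall j, (j < n)%N -> p^`(j).[0] = 0) ->
  (forall j, (j < n)%N -> p^`(j).[b] = 0) ->
  integ b ('X^k * p^`(n)) = 0.
Proof.
elim: k n => [|k IH] [|n]// kn h0 hb; rewrite derivnS.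
  by rewrite mul1r integ_deriv h0// hb// subr0.
rewrite integ_by_parts hb// mulr0 sub0r IH ?mulr0 ?oppr0// => j jn.
  by rewrite h0// ltnW.
by rewrite hb// ltnW.
Qed.

(** * Orders of vanishing under differentiation and integration *)

Lemma deriv_exp_XsubC b n :
  (('X - b%:P) ^+ n.+1)^`() = ('X - b%:P) ^+ n *+ n.+1.
Proof. by rewrite deriv_exp derivXsubC mul1r. Qed.

Lemma dvdp_exp_XsubC_deriv b n p :
  ('X - b%:P) ^+ n.+1 %| p -> ('X - b%:P) ^+ n %| p^`().
Proof.
move=> /dvdpP[q ->]; rewrite derivM deriv_exp_XsubC mulrnAr -mulrnAl.
by apply: dvdp_add; rewrite ?exprS ?mulrA dvdp_mulIr.
Qed.

Lemma derivn_root_exp b n p : ('X - b%:P) ^+ n %| p ->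
  forall j, (j < n)%N -> p^`(j).[b] = 0.
Proof.
elim: n p => [|n IH] p h [|j]//; rewrite ltnS => jn.
  apply/eqP; rewrite -/(root _ _) -dvdp_XsubCl; apply: dvdp_trans h.
  by rewrite exprS dvdp_mulr.
by rewrite derivSn IH// dvdp_exp_XsubC_deriv.
Qed.

(** The antiderivative vanishes at [b], and in characteristic 0 differentiation lowers the order of
    a zero by exactly one. *)
Lemma dvdp_exp_XsubC_antideriv b n p :
  ('X - b%:P) ^+ n %| p -> integ b p = 0 ->
  ('X - b%:P) ^+ n.+1 %| antideriv p.
Proof.
move=> h ib; have [->|p0] := eqVneq p 0; first by rewrite linear0 dvdp0.
have w0 : antideriv p != 0.
  by apply: contra p0 => /eqP e; rewrite -(deriv_antideriv p) e deriv0.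
have [k [q]] := multiplicity_XsubC (antideriv p) b; rewrite w0 /= => rq Ew.
have k0 : (0 < k)%N.
  case: k Ew => // Ew; move: rq; rewrite -[q]mulr1 -(expr0 ('X - b%:P)) -Ew.
  by rewrite /root [_.[b]]ib eqxx.
case: k Ew k0 => // k Ew _.
rewrite Ew dvdp_mull// dvdp_exp2l//.
have E : p = ('X - b%:P) ^+ k * (q^`() * ('X - b%:P) + q *+ k.+1).
  rewrite -(deriv_antideriv p) Ew derivM deriv_exp_XsubC exprS /=.
  by rewrite mulrnAr mulrDr mulrnAr; congr (_ + _ *+ _); ring.
rewrite ltnS leqNgt; apply/negP => kn.
have : ('X - b%:P) ^+ k.+1 %| p by apply: dvdp_trans h; rewrite dvdp_exp2l.
rewrite E exprSr dvdp_mul2l ?expf_neq0 ?polyXsubC_eq0// dvdp_XsubCl.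
rewrite /root !hornerE subrr mulr0 add0r hornerMn mulrn_eq0 /=.
by apply/negP.
Qed.

(** A converse of [integ_ort_derivn]: vanishing moments force a zero of order [n] of the [n]-fold
    antiderivative. *)
Lemma dvdp_exp_iter_antideriv b n p :
  (forall k, (k < n)%N -> integ b ('X^k * p) = 0) ->
  ('X - b%:P) ^+ n %| iter n antideriv p.
Proof.
elim: n p => [|n IH] p h; first by rewrite dvd1p.
rewrite iterS; apply: dvdp_exp_XsubC_antideriv; first by apply: IH => k kn; exact: h (ltnW _).
(* It remains to see that the [n]-fold antiderivative has integral 0. By parts, moment [k + 1] of
   [p] is a nonzero multiple of moment [k] of [antideriv p], so the hypothesis passes to
   [antideriv p] with one moment fewer. *)
elim: n p h {IH} => [|n IH] p h; first by rewrite -(h 0%N isT) expr0 mul1r.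
rewrite iterSr; apply: IH => k kn.
have i0 : (antideriv p).[b] = 0 by have := h 0%N isT; rewrite expr0 mul1r.
have := h k.+1 kn; rewrite -{1}(deriv_antideriv p) integ_by_parts i0 mulr0 sub0r.
by move/eqP; rewrite oppr_eq0 mulf_eq0 pnatr_eq0/= => /eqP.
Qed.

Lemma dvdp_prod_exp_XsubC (bs : seq F) n p : uniq bs ->
  (forall b, b \in bs -> ('X - b%:P) ^+ n %| p) ->
  (\prod_(b <- bs) ('X - b%:P)) ^+ n %| p.
Proof.
elim: bs => [|b bs IH] /=; first by rewrite big_nil expr1n dvd1p.
move=> /andP[bbs ubs] h; rewrite big_cons exprMn Gauss_dvdp.
  by rewrite h ?mem_head//= IH// => c cbs; rewrite h// inE cbs orbT.
by rewrite coprimep_expl// coprimep_expr// coprimep_sym coprimep_XsubC root_prod_XsubC.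
Qed.

Lemma iter_antideriv_eq0 n p : iter n antideriv p = 0 -> p = 0.
Proof.
elim: n => // n IH /(congr1 (@deriv F)).
by rewrite /= deriv_antideriv deriv0; exact: IH.
Qed.

(* The n-fold antiderivative of u has n-fold zeros at 0 and at each point of
   bs, which is one more than its degree allows. *)
Lemma ort_eq0 (bs : seq F) n u : uniq (0 :: bs) ->
  (size u <= size bs * n)%N ->
  (forall b k, b \in bs -> (k < n)%N -> integ b ('X^k * u) = 0) ->
  u = 0.
Proof.
move=> ubs su h; apply: (@iter_antideriv_eq0 n); apply/eqP/negPn/negP => w0.
set P : {poly F} := (\prod_(b <- 0 :: bs) ('X - b%:P)) ^+ n.
have sP : (size P).-1 = ((size bs).+1 * n)%N.
  by rewrite size_exp size_prod_XsubC.
have P0 : (0 < size P)%N.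
  by rewrite size_poly_gt0 expf_neq0// monic_neq0// monic_prod_XsubC.
have /(dvdp_leq w0) le_w : P %| iter n antideriv u.
  apply: dvdp_prod_exp_XsubC => // b; rewrite inE => /predU1P[->|bbs].
    by apply: dvdp_exp_iter_antideriv => k _; rewrite /integ antideriv_horner0.
  by apply: dvdp_exp_iter_antideriv => k kn; exact: h.
have w1 : (size (iter n antideriv u) <= size u + n)%N.
  elim: n {w0 su h P sP P0 le_w} => [|n IH]; rewrite ?addn0//=.
  by rewrite addnS; apply: leq_trans (size_antideriv _) _.
rewrite mulSn in sP; move: sP P0 su (leq_trans le_w w1).
by move: (size P) (size u) => a b; lia.
Qed.

End Antiderivative.

(** * Pade approximants *)

Section Pade.
Variable F : numFieldType.
Variables (m n : nat) (bt : 'I_m -> F).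
Implicit Types p c : {poly F}.

Lemma poly_sumE p K : (size p <= K)%N -> p = \sum_(k < K) p`_k *: 'X^k.
Proof.
move=> sp; rewrite -poly_def; apply/polyP => k; rewrite coef_poly.
by case: ltnP => // Kk; rewrite nth_default// (leq_trans sp).
Qed.

(** For [p] of size at most [N] this is the quotient of [p - p(1)] by ['X - 1]; with [N] fixed it is
    linear in [p]. *)
Definition divdiff1 (N : nat) p : {poly F} :=
  \sum_(k < N) p`_k *: \sum_(j < k) 'X^j.

Fact divdiff1_is_linear N : linear (divdiff1 N).
Proof.
move=> a p q; rewrite /divdiff1 scaler_sumr -big_split; apply: eq_bigr => k _ /=.
by rewrite coefD coefZ scalerDl scalerA.
Qed.

HB.instance Definition _ N := GRing.isLinear.Build F {poly F} {poly F} _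
  (divdiff1 N) (divdiff1_is_linear N).

Lemma mul_divdiff1 N p : (size p <= N)%N ->
  ('X - 1) * divdiff1 N p = p - p.[1]%:P.
Proof.
move=> sp; have Ep := poly_sumE sp.
rewrite [in RHS](horner_coef_wide _ sp) [X in _ = X - _]Ep /divdiff1 mulr_sumr.
rewrite rmorph_sum/= -sumrB; apply: eq_bigr => k _.
by rewrite expr1n mulr1 -scalerAr -subrX1 scalerBr alg_polyC.
Qed.

Lemma size_divdiff1 N p : (size (divdiff1 N p) <= N.-1)%N.
Proof.
apply: leq_trans (size_sum _ _ _) _; apply/bigmax_leqP => k _.
apply: leq_trans (size_scale_leq _ _) _.
apply: leq_trans (size_sum _ _ _) _; apply/bigmax_leqP => j _.
by rewrite size_polyXn; case: N k j => [[]//|N] k j; have := ltn_ord k; have := ltn_ord j; lia.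
Qed.

Definition pade_kernel : {poly F} := 'X^n * \prod_i ('X - (bt i)%:P) ^+ n.

(** The divided derivative includes the factor 1/n!, so it multiplies coefficients by binomials and
    creates no denominators. *)
Definition pade c : {poly F} := (c * pade_kernel)^`N(n).

Fact pade_is_linear : linear pade.
Proof. by move=> a p q; rewrite /pade mulrDl -scalerAl linearD linearZ. Qed.

HB.instance Definition _ := GRing.isLinear.Build F {poly F} {poly F} _
  pade pade_is_linear.

Lemma size_pade_kernel : size pade_kernel = (n + m * n).+1.
Proof.
rewrite /pade_kernel prodrXl (_ : 'X^n = ('X - 0%:P) ^+ n); last by rewrite subr0.
rewrite -exprMn.
set P := _ * _.
have mP : P \is monic.
  by rewrite monicMl ?monicXsubC// monic_prod_XsubC.
have sP : size P = m.+2.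
  rewrite size_monicM ?monicXsubC ?monic_neq0 ?monic_prod_XsubC//.
  by rewrite size_XsubC size_prod_XsubC [index_enum _]unlock -enumT -cardE card_ord.
have := size_exp P n; rewrite sP /= mulSn => E.
have : (0 < size (P ^+ n))%N by rewrite size_poly_gt0 expf_neq0// monic_neq0.
by move: E; case: (size _) => //= k ->.
Qed.

Lemma pade_kernel_neq0 : pade_kernel != 0.
Proof. by rewrite -size_poly_gt0 size_pade_kernel. Qed.

Lemma size_pade c : (size (pade c) <= (size c).-1 + (m * n).+1)%N.
Proof.
apply/leq_sizeP => j hj; rewrite coef_nderivn nth_default ?mul0rn//.
apply: leq_trans (size_polyMleq _ _) _; rewrite size_pade_kernel; lia.
Qed.

Lemma integ_pade c i k : (k < n)%N -> integ (bt i) ('X^k * pade c) = 0.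
Proof.
move=> kn; have h : integ (bt i) ('X^k * (c * pade_kernel)^`(n)) = 0.
  apply: integ_ort_derivn => // j jn; apply: (derivn_root_exp (n := n)) => //.
    by rewrite subr0 dvdp_mull// dvdp_mulr.
  by rewrite dvdp_mull// /pade_kernel (bigD1 i)//= mulrCA dvdp_mulr.
move/eqP: h; rewrite nderivn_def mulrnAr linearMn/= mulrn_eq0 gtn_eqF ?fact_gt0//=.
by move/eqP.
Qed.

(** The kernel is divisible by ['X^n], so the [n]-th derivative kills no coefficient of the
    product. *)
Lemma pade_eq0 c : pade c = 0 -> c = 0.
Proof.
move=> h; apply: (mulIf pade_kernel_neq0); rewrite mul0r.
apply/polyP => k; rewrite coef0 /pade_kernel mulrCA coefXnM.
case: ltnP => // nk; have := coef_nderivn n (c * pade_kernel) (k - n).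
rewrite -/(pade c) h coef0 subnKC// /pade_kernel mulrCA coefXnM ltnNge nk /=.
by move/esym/eqP; rewrite mulrn_eq0 gtn_eqF ?bin_gt0//= => /eqP.
Qed.

Hypotheses (bt_inj : injective bt) (bt_neq0 : forall i, bt i != 0).

Let N := (m.+1 + m * n)%N.

(** Since [pade c] vanishes at 1, it is [('X - 1) * u]. Its orthogonality to ['X^k] for [k < n] says
    that consecutive moments of [u] agree, and moment 0 is zero by hypothesis, so moments 0 to [n]
    of [u] all vanish. *)
Lemma pade_indep c : (size c <= m.+1)%N -> (pade c).[1] = 0 ->
  (forall i, integ (bt i) (divdiff1 N (pade c)) = 0) -> c = 0.
Proof.
move=> sc A1 hB; apply: pade_eq0.
have sA : (size (pade c) <= N)%N.
  by apply: leq_trans (size_pade c) _; rewrite /N; lia.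
have := mul_divdiff1 sA; rewrite A1 subr0; set u := divdiff1 _ _ => Eu.
suff u0 : u = 0 by rewrite -Eu u0 mulr0.
(* The size of [u] is at most [N.-1 = m * n.+1], exactly what [m] points with [n.+1] moments each
   allow. *)
apply: (@ort_eq0 _ (codom bt) n.+1).
- rewrite /= map_inj_uniq ?enum_uniq// andbT.
  by apply/codomP => -[i /eqP]; rewrite eq_sym (negbTE (bt_neq0 i)).
- rewrite size_codom card_ord; apply: leq_trans (size_divdiff1 _ _) _.
  by rewrite /N /= mulnS.
- move=> _ k /codomP[i ->]; elim: k => [|k IH] kn; first by rewrite mul1r hB.
  apply/eqP; have := integ_pade c i (kn : (k < n)%N).
  rewrite -Eu mulrCA mulrBl mul1r linearB/=.
  by rewrite mulrA -exprS IH ?subr0// => [->//|]; exact: ltnW.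
Qed.

Definition pade_mx : 'M[F]_m.+1 := \matrix_(l, j)
  if unlift ord0 j is Some i then integ (bt i) (divdiff1 N (pade 'X^l))
  else (pade 'X^l).[1].

(** By linearity, a combination of the rows is the row attached to a single [c] of size at most
    [m.+1], to which [pade_indep] applies. *)
Lemma pade_mx_free : row_free pade_mx.
Proof.
apply: inj_row_free => v hv; pose c := rVpoly v.
have sc : (size c <= m.+1)%N by exact: size_poly.
have cE : c = \sum_(l < m.+1) v 0 l *: 'X^l.
  rewrite /c /rVpoly poly_def; apply: eq_bigr => l _.
  by rewrite (insubT (fun l => l < m.+1)%N (ltn_ord l)); congr (v 0 _ *: _); apply: val_inj.
have hj j : \sum_l v 0 l * pade_mx l j = 0.
  by have /matrixP/(_ 0 j) := hv; rewrite !mxE.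
suff c0 : c = 0 by rewrite -(rVpolyK v) -/c c0 linear0.
apply: pade_indep => //.
  rewrite cE linear_sum horner_sum.
  rewrite (eq_bigr (fun l => v 0 l * pade_mx l ord0)) => [|l _].
    exact: hj.
  by rewrite linearZ/= hornerZ mxE unlift_none.
move=> i; pose phi c := integ (bt i) (divdiff1 N (pade c)).
have phiP a p q : phi (a *: p + q) = a * phi p + phi q by rewrite /phi !linearP.
have phi0 : phi 0 = 0 by rewrite /phi !linear0.
have phiD : {morph phi : p q / p + q}.
  by move=> p q; rewrite -[p]scale1r phiP mul1r scale1r.
rewrite -/(phi c) cE (big_morph phi phiD phi0).
rewrite (eq_bigr (fun l => v 0 l * pade_mx l (lift ord0 i))) => [|l _].
  exact: hj.
by rewrite -[_ *: _]addr0 phiP phi0 addr0 mxE liftK.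
Qed.

Lemma pade_form_neq0 (mu0 : F) (mu : 'I_m -> F) :
  (mu0 != 0) || [exists i, mu i != 0] ->
  exists l : 'I_m.+1, mu0 * (pade 'X^l).[1] +
    \sum_i mu i * integ (bt i) (divdiff1 N (pade 'X^l)) != 0.
Proof.
move=> mu_n0; apply/existsP; apply: contraTT mu_n0 => /existsPn h.
pose w : 'cV[F]_m.+1 := \col_j if unlift ord0 j is Some i then mu i else mu0.
have : pade_mx *m w = 0.
  apply/matrixP => l j; rewrite !mxE big_ord_recl !mxE unlift_none.
  have /negPn/eqP E := h l; apply: etrans E; rewrite mulrC; congr (_ + _).
  by apply: eq_bigr => i _; rewrite !mxE liftK mulrC.
have U : pade_mx \in unitmx by rewrite -row_free_unit pade_mx_free.
move/(congr1 (mulmx (invmx pade_mx))); rewrite mulKmx// mulmx0 => w0.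
have wj j : w j 0 = 0 by rewrite w0 mxE.
rewrite negb_or negbK; apply/andP; split.
  by have := wj ord0; rewrite mxE unlift_none => ->.
by apply/existsPn => i; have := wj (lift ord0 i); rewrite mxE liftK => ->; rewrite negbK.
Qed.

End Pade.

(** * Bounds on the coefficients *)

Section PadicAbsInt.
Variables (p : nat) (hp : prime p).

Lemma padic_abs_int (z : int) : z != 0 ->
  padic_abs p z%:~R = (p ^ logn p `|z|)%:R^-1.
Proof.
move=> z0; rewrite -[z%:~R]divr1 (padic_abs_frac hp z0 (oner_neq0 _)).
by rewrite /= logn1 sub0r -exprnN natrX.
Qed.

Lemma padic_abs_int_le1 (z : int) : padic_abs p z%:~R <= 1.
Proof.
have [->|z0] := eqVneq z 0; first by rewrite padic_abs0.
rewrite padic_abs_int// invf_le1 ?ltr0n ?expn_gt0 ?prime_gt0//.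
by rewrite ler1n expn_gt0 prime_gt0.
Qed.

Lemma padic_abs_isint_le1 (x : rat) : x \is a Num.int -> padic_abs p x <= 1.
Proof. by move=> /intrP[z ->]; exact: padic_abs_int_le1. Qed.

(** The power of [p] dividing a nonzero integer is at most its size. This is the only source of
    lower bounds. *)
Lemma padic_abs_int_ge (x : rat) : x \is a Num.int -> x != 0 ->
  `|x|^-1 <= padic_abs p x.
Proof.
move=> /intrP[z ->]; rewrite intr_eq0 => z0; rewrite padic_abs_int//.
have -> : `|z%:~R| = `|z|%N%:R :> rat by rewrite -intr_norm -abszE.
rewrite lef_pV2 ?posrE ?ltr0n ?absz_gt0 ?expn_gt0 ?prime_gt0//.
by rewrite ler_nat dvdn_leq ?absz_gt0// pfactor_dvdnn.
Qed.

Lemma padic_abs_Vnat (k : nat) : padic_abs p k.+1%:R^-1 <= k.+1%:R.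
Proof.
rewrite padic_absV//; have nz : k.+1%:R != 0 :> rat by rewrite pnatr_eq0.
have := padic_abs_int_ge (natr_int _ k.+1) nz.
rewrite ger0_norm// => h; rewrite -[leRHS]invrK lef_pV2 ?posrE ?invr_gt0 ?ltr0n//.
exact: padic_abs_gt0.
Qed.

Lemma padic_abs_sum (I : Type) (r : seq I) (P : pred I) (f : I -> rat) (B : rat) :
  0 <= B -> (forall i, P i -> padic_abs p (f i) <= B) ->
  padic_abs p (\sum_(i <- r | P i) f i) <= B.
Proof.
move=> B0 h; apply: (big_ind (fun x => padic_abs p x <= B)) => [|x y hx hy|//].
  by rewrite padic_abs0.
apply: le_trans (padic_abs_ultra hp x y) _.
by rewrite ge_max hx hy.
Qed.

Lemma padic_abs_exp (x : rat) k : padic_abs p (x ^+ k) = padic_abs p x ^+ k.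
Proof.
elim: k => [|k IH]; first by rewrite !expr0 padic_abs1.
by rewrite !exprS padic_absM// IH.
Qed.

(** Nonzero values are integral powers of [p], so the largest one below 1 is [1/p]. *)
Lemma padic_abs_lt1_le_half (x : rat) : padic_abs p x < 1 -> padic_abs p x <= 2^-1.
Proof.
have [->|x0] := eqVneq x 0; first by rewrite padic_abs0.
rewrite /padic_abs (negbTE x0); set e := (_ - _ : int).
have p1 : 1 < p%:R :> rat by rewrite ltr1n prime_gt1.
have [e0|e0] := leP 0 e.
  by rewrite -(gez0_abs e0) -exprnP ltNge exprn_ege1// ltW.
move=> _; have -> : e = - `|e|%N%:Z by lia.
rewrite -exprnN lef_pV2 ?posrE ?exprn_gt0 ?(lt_trans ltr01 p1)//.
have : 2 <= p%:R :> rat by rewrite ler_nat prime_gt1.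
move=> /le_trans; apply; rewrite -[X in X <= _]expr1.
by apply: ler_weXn2l; [exact: ltW|lia].
Qed.

End PadicAbsInt.

(** The ratio of consecutive terms is [a * (z + 1) / z], at most 1 once [z >= 1]. *)
Lemma mul_expr_nincr (a : rat) (y z : nat) : 0 <= a -> a <= 2^-1 ->
  (0 < y <= z)%N -> z%:R * a ^+ z <= y%:R * a ^+ y.
Proof.
move=> a0 a2 /andP[y0]; elim: z => [|z IH]; first by rewrite leqn0 => /eqP ->.
rewrite leq_eqVlt => /predU1P[->//|]; rewrite ltnS => yz.
apply: le_trans (IH yz); rewrite exprS mulrA ler_wpM2r ?exprn_ge0//.
have z1 : 1 <= z%:R :> rat by rewrite ler1n; lia.
rewrite -natr1; nra.
Qed.

(** * Size and denominators of the coefficients of the approximants *)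

Section PadeBounds.
Variables (m n : nat) (bt : 'I_m -> rat).

(** Multiplicative bounds are checked one linear factor at a time: [i] counts the factors ['X] and
    [j] the factors ['X - b_k]. *)
Lemma pade_kernel_ind (Pr : nat -> nat -> {poly rat} -> Prop) l :
  Pr 0%N 0%N 1 ->
  (forall i j q, Pr i j q -> Pr i.+1 j ('X * q)) ->
  (forall i j k q, Pr i j q -> Pr i j.+1 (('X - (bt k)%:P) * q)) ->
  Pr (l + n)%N (m * n)%N ('X^l * pade_kernel n bt).
Proof.
move=> h1 hX hb; rewrite /pade_kernel mulrA -exprD.
have {}hX i j q : Pr 0%N j q -> Pr i j ('X^i * q).
  move=> hq; elim: i => [|i IH]; first by rewrite mul1r.
  by rewrite exprS -mulrA; exact: hX.
apply: hX.
have {}hb j e k q : Pr 0%N j q -> Pr 0%N (e + j)%N (('X - (bt k)%:P) ^+ e * q).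
  move=> hq; elim: e => [|e IH]; first by rewrite mul1r.
  by rewrite exprS -mulrA; exact: hb.
rewrite -[X in (X * _)%N]card_ord cardE -[X in \prod_(_ <- X) _]/(index_enum _).
rewrite [index_enum _]unlock -enumT; elim: (enum _) => [|k s IH].
  by rewrite big_nil.
by rewrite big_cons /= mulSn; exact: hb.
Qed.

Section Gauss.
Variables (p : nat) (hp : prime p) (a : rat).
Hypotheses (a0 : 0 < a) (ha : forall i, padic_abs p (bt i) <= a).

(** This bounds the Gauss norm of radius [a]: every linear factor has norm at most [a]. *)
Lemma pade_kernel_gauss l s :
  padic_abs p ('X^l * pade_kernel n bt)`_s * a ^+ s <= a ^+ (l + n + m * n).
Proof.
move: s; apply: (pade_kernel_ind (Pr := fun i j q => forall s,
  padic_abs p q`_s * a ^+ s <= a ^+ (i + j))) => [s|i j q h s|i j k q h s].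
- rewrite coef1; case: s => [|s]; first by rewrite padic_abs1// !mulr1.
  by rewrite padic_abs0 mul0r expr0 ler01.
- rewrite coefXM; case: s => [|s]; first by rewrite padic_abs0 mul0r exprn_ge0// ltW.
  by rewrite exprS mulrCA addSn exprS ler_wpM2l ?(ltW a0)//=.
rewrite mulrBl coefB coefXM coefCM addnS exprS.
have h2 : padic_abs p (bt k * q`_s) * a ^+ s <= a * a ^+ (i + j).
  by rewrite padic_absM// -mulrA ler_pM ?mulr_ge0 ?padic_abs_ge0 ?exprn_ge0 ?(ltW a0).
have h1 : padic_abs p (if s == 0%N then 0 else q`_s.-1) * a ^+ s <= a * a ^+ (i + j).
  case: s {h2} => [|s]; first by rewrite padic_abs0 mul0r mulr_ge0 ?exprn_ge0 ?ltW.
  by rewrite exprS mulrCA ler_wpM2l ?(ltW a0)//=.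
set x := if _ then _ else _ in h1 *.
apply: le_trans (_ : Num.max (padic_abs p x) (padic_abs p (bt k * q`_s)) * a ^+ s <= _).
  rewrite ler_wpM2r ?exprn_ge0 ?(ltW a0)// -(padic_absN p (bt k * _)).
  exact: (padic_abs_ultra hp).
by rewrite maxr_pMl ?exprn_ge0 ?(ltW a0)// ge_max h1 h2.
Qed.

Lemma pade_gauss l s :
  padic_abs p (pade n bt 'X^l)`_s * a ^+ s <= a ^+ (l + m * n).
Proof.
rewrite coef_nderivn -mulr_natr padic_absM//.
have an : 0 < a ^+ n by rewrite exprn_gt0.
rewrite -(ler_pM2l an) -exprD.
have -> : (n + (l + m * n) = l + n + m * n)%N by lia.
apply: le_trans (pade_kernel_gauss l (n + s)); rewrite exprD.
set c := padic_abs p _`_ _; set d := padic_abs p _%:R.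
have d1 : d <= 1 by apply: padic_abs_isint_le1 => //; exact: natr_int.
have c0 : 0 <= c by exact: padic_abs_ge0.
have -> : a ^+ n * (c * d * a ^+ s) = d * (c * (a ^+ n * a ^+ s)) by ring.
by rewrite ler_piMl// !mulr_ge0// exprn_ge0// ltW.
Qed.

End Gauss.

Section Integrality.
Variable Q : nat.
Hypotheses (Q0 : (0 < Q)%N) (hQ : forall i, Q%:R * bt i \is a Num.int).

Let q0 : Q%:R != 0 :> rat. Proof. by rewrite pnatr_eq0 -lt0n. Qed.

(** Rescaling the variable by [Q] turns ['X - b_k] into ['X - Q * b_k], which is integral. The
    quotient of powers of [Q] replaces the exponent [l + n + m * n - s] and avoids truncated
    subtraction. *)
Lemma pade_kernel_int l s :
  ('X^l * pade_kernel n bt)`_s * Q%:R ^+ (l + n + m * n) / Q%:R ^+ s \is a Num.int.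
Proof.
move: s; apply: (pade_kernel_ind (Pr := fun i j q => forall s,
  q`_s * Q%:R ^+ (i + j) / Q%:R ^+ s \is a Num.int)) => [s|i j q h s|i j k q h s].
- by rewrite coef1; case: s => [|s]; rewrite ?mul0r// !mul1r divr1.
- rewrite coefXM; case: s => [|s]; first by rewrite !mul0r.
  rewrite addSn !exprS /=; move: (h s); set x := q`_s.
  suff -> : x * Q%:R ^+ (i + j) / Q%:R ^+ s =
    x * (Q%:R * Q%:R ^+ (i + j)) / (Q%:R * Q%:R ^+ s) by [].
  by field; rewrite expf_neq0.
rewrite mulrBl coefB coefXM coefCM addnS !mulrBl rpredB//.
  case: s => [|s]; first by rewrite !mul0r.
  rewrite !exprS /=; move: (h s); set x := q`_s.
  suff -> : x * Q%:R ^+ (i + j) / Q%:R ^+ s =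
    x * (Q%:R * Q%:R ^+ (i + j)) / (Q%:R * Q%:R ^+ s) by [].
  by field; rewrite expf_neq0.
have -> : bt k * q`_s * Q%:R ^+ (i + j).+1 / Q%:R ^+ s =
    (Q%:R * bt k) * (q`_s * Q%:R ^+ (i + j) / Q%:R ^+ s) by rewrite exprS; ring.
by rewrite rpredM.
Qed.

Lemma pade_int l s :
  (pade n bt 'X^l)`_s * Q%:R ^+ (l + m * n) / Q%:R ^+ s \is a Num.int.
Proof.
rewrite coef_nderivn -[_`_ _ *+ _]mulr_natr; set c := 'C(_, _)%:R.
have := pade_kernel_int l (n + s); set x := _`_ _.
have -> : (l + n + m * n = n + (l + m * n))%N by lia.
rewrite !(exprD _ n) => h.
have -> : x * c * Q%:R ^+ (l + m * n) / Q%:R ^+ s =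
    c * (x * (Q%:R ^+ n * Q%:R ^+ (l + m * n)) / (Q%:R ^+ n * Q%:R ^+ s)).
  by field; rewrite !expf_neq0.
by rewrite rpredM// natr_int.
Qed.

End Integrality.

Section Archimedean.
Variable M : rat.
Hypotheses (M1 : 1 < M) (hM : forall i, `|bt i| <= M).

Let M0 : 0 < M. Proof. exact: lt_trans M1. Qed.

(** A weighted sum of absolute coefficients, under which ['X] costs [2 * M] and ['X - b_k] at most
    [3 * M]. Radius [2 * M] instead of [M] pays for the binomials of the divided derivative, as
    ['C(n + s, n) <= 2 ^ (n + s)]. *)
Lemma pade_kernel_norm l K :
  \sum_(s < K) `|('X^l * pade_kernel n bt)`_s| * (2 * M) ^+ s <=
  (2 * M) ^+ (l + n) * (3 * M) ^+ (m * n).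
Proof.
have M2 : 0 < 2 * M by rewrite mulr_gt0.
have sM s : 0 <= (2 * M) ^+ s by rewrite exprn_ge0// ltW.
have shift (q : {poly rat}) K' :
    \sum_(s < K') `|('X * q)`_s| * (2 * M) ^+ s <=
    2 * M * \sum_(s < K') `|q`_s| * (2 * M) ^+ s.
  case: K' => [|K']; first by rewrite !big_ord0 mulr0.
  rewrite big_ord_recl coefXM normr0 mul0r add0r big_ord_recr /= mulrDr.
  rewrite mulr_sumr; apply: ler_wpDr; first by rewrite !mulr_ge0 ?(ltW M0).
  by apply: ler_sum => s _; rewrite coefXM /= exprS mulrCA.
move: K; apply: (pade_kernel_ind (Pr := fun i j q => forall K,
  \sum_(s < K) `|q`_s| * (2 * M) ^+ s <= (2 * M) ^+ i * (3 * M) ^+ j)).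
- case=> [|K]; first by rewrite big_ord0.
  rewrite big_ord_recl coef1 normr1 !expr0 !mulr1 big1 ?addr0// => s _.
  by rewrite coef1 normr0 mul0r.
- move=> i j q h K; apply: le_trans (shift _ _) _.
  by rewrite exprS -[leRHS]mulrA ler_wpM2l// ltW.
move=> i j k q h K.
apply: le_trans (_ : \sum_(s < K) `|('X * q)`_s| * (2 * M) ^+ s +
   M * \sum_(s < K) `|q`_s| * (2 * M) ^+ s <= _).
  rewrite mulr_sumr -big_split; apply: ler_sum => s _ /=.
  rewrite mulrA -mulrDl ler_wpM2r// mulrBl coefB coefCM.
  by apply: le_trans (ler_normB _ _) _; rewrite lerD2l normrM ler_wpM2r.
rewrite exprS mulrCA; apply: le_trans (lerD (shift _ _) (lexx _)) _.
rewrite -mulrDl (_ : 2 * M + M = 3 * M); last by ring.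
by rewrite ler_wpM2l// mulr_ge0// ltW.
Qed.

Lemma pade_norm l K :
  \sum_(s < K) `|(pade n bt 'X^l)`_s| * M ^+ s <=
  2 ^+ (l + n) * 3 ^+ (m * n) * M ^+ (l + m * n).
Proof.
have Mn : 0 < M ^+ n by rewrite exprn_gt0.
rewrite -(ler_pM2l Mn).
have -> : M ^+ n * (2 ^+ (l + n) * 3 ^+ (m * n) * M ^+ (l + m * n)) =
    (2 * M) ^+ (l + n) * (3 * M) ^+ (m * n).
  by rewrite !exprMn !exprD; ring.
apply: le_trans (pade_kernel_norm l (n + K)).
rewrite big_split_ord /= mulr_sumr; apply: ler_wpDl.
  by apply: sumr_ge0 => s _; rewrite mulr_ge0// exprn_ge0// mulr_ge0// ltW.
apply: ler_sum => s _; rewrite coef_nderivn normrMn -[`|_| *+ _]mulr_natr.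
set x := `|_|; rewrite exprMn.
have -> : M ^+ n * (x * 'C(n + s, n)%:R * M ^+ s) = x * ('C(n + s, n)%:R * M ^+ (n + s)).
  by rewrite exprD; ring.
apply: ler_wpM2l; rewrite ?normr_ge0//.
rewrite ler_wpM2r ?exprn_ge0 ?(ltW M0)//.
by rewrite -natrX ler_nat leq_bin_exp2.
Qed.

End Archimedean.
End PadeBounds.

(** * Explicit integrals of polynomials and difference quotients *)

Section IntegFormulas.
Variable F : numFieldType.
Implicit Types (A : {poly F}) (b : F).

Lemma integ_Xn_mul b A k K : (size A <= K)%N ->
  integ b ('X^k * A) = \sum_(s < K) A`_s * (b ^+ (k + s).+1 / (k + s).+1%:R).
Proof.
move=> sA; rewrite [in LHS](poly_sumE sA) mulr_sumr linear_sum.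
by apply: eq_bigr => s _; rewrite -scalerAr linearZ/= -exprD integXn.
Qed.

Lemma integ_Xn_mul_divdiff1 b A k K :
  integ b ('X^k * divdiff1 K A) =
  \sum_(s < K) A`_s * \sum_(j < s) b ^+ (k + j).+1 / (k + j).+1%:R.
Proof.
rewrite /divdiff1 mulr_sumr linear_sum; apply: eq_bigr => s _.
rewrite -scalerAr linearZ/= mulr_sumr linear_sum; congr (_ * _).
by apply: eq_bigr => j _; rewrite -exprD/= integXn.
Qed.

Lemma integ_divdiff1 b A K :
  integ b (divdiff1 K A) =
  \sum_(s < K) A`_s * \sum_(j < s) b ^+ j.+1 / j.+1%:R.
Proof. by rewrite -[divdiff1 K A]mul1r -(expr0 'X) integ_Xn_mul_divdiff1. Qed.

(* Splits A(1)/(1 - x) into a polynomial and a remainder, with 1/(1 - x)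
   truncated to degree < k. *)
Lemma integ_geometric b A k K : (size A <= K)%N ->
  A.[1] * integ b (\sum_(j < k) 'X^j) - integ b (divdiff1 K A) =
  \sum_(j < k) integ b ('X^j * A) - integ b ('X^k * divdiff1 K A).
Proof.
move=> sA; set B := divdiff1 K A; set T := \sum_(j < k) 'X^j.
have BE : ('X - 1) * B = A - A.[1]%:P by exact: mul_divdiff1.
have TE : ('X - 1) * T = 'X^k - 1 by rewrite -subrX1.
have E : A.[1] *: T - B = T * A - 'X^k * B.
  have X1 : 'X - 1 != 0 :> {poly F} by rewrite -polyC1 polyXsubC_eq0.
  apply: (mulfI X1); rewrite mulrBr -scalerAr TE BE mulrBr mulrA TE mulrCA BE.
  by rewrite -mul_polyC; ring.
have /(congr1 (integ b)) := E; rewrite !linearB linearZ/= => ->.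
by rewrite /T mulr_suml linear_sum.
Qed.

End IntegFormulas.

(** * Remainder, denominators and size of the approximating forms *)

Section PadeForms.
Variables (m n l : nat) (bt : 'I_m -> rat).
Hypothesis (lm : (l <= m)%N).
Let D := (l + m * n)%N.
Let K := (m.+1 + m * n)%N.
Let A := pade n bt 'X^l.

Lemma size_pade_Xn : (size A <= D.+1)%N.
Proof.
by apply: leq_trans (size_pade _ _ _) _; rewrite size_polyXn /D addnS.
Qed.

Section Padic.
Variables (p : nat) (hp : prime p) (a : rat).
Hypotheses (a0 : 0 < a) (a2 : a <= 2^-1) (ha : forall i, padic_abs p (bt i) <= a).

Lemma padic_abs_exp_div i y :
  padic_abs p (bt i ^+ y.+1 / y.+1%:R) <= y.+1%:R * a ^+ y.+1.
Proof.
rewrite padic_absM// mulrC ler_pM ?padic_abs_ge0 ?padic_abs_Vnat//.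
by rewrite padic_abs_exp// lerXn2r ?nnegrE ?padic_abs_ge0// ltW.
Qed.

(** In the term of index [s], the Gauss bound on the coefficient trades the factor [a ^+ s] for
    [a ^+ D]. *)
Lemma padic_abs_integ_pade i k :
  padic_abs p (integ (bt i) ('X^k * A)) <= (D + k).+1%:R * a ^+ (D + k).+1.
Proof.
rewrite (integ_Xn_mul _ _ size_pade_Xn); apply: padic_abs_sum => //.
  by rewrite mulr_ge0// exprn_ge0// ltW.
move=> s _; rewrite padic_absM//.
apply: le_trans (ler_wpM2l (padic_abs_ge0 hp _) (padic_abs_exp_div i _)) _.
have -> : (k + s).+1 = (s + k.+1)%N by lia.
set v := padic_abs p _; rewrite -addnS (exprD a D) (exprD a s).
have -> : v * ((s + k.+1)%:R * (a ^+ s * a ^+ k.+1)) =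
    (s + k.+1)%:R * (v * a ^+ s * a ^+ k.+1) by ring.
have ak : 0 <= a ^+ k.+1 by rewrite exprn_ge0// ltW.
have vs : 0 <= v * a ^+ s by rewrite mulr_ge0 ?padic_abs_ge0// exprn_ge0// ltW.
apply: ler_pM => //; [exact: mulr_ge0|by rewrite ler_nat leq_add2r -ltnS|].
by rewrite ler_wpM2r//; exact: pade_gauss.
Qed.

Lemma padic_abs_integ_divdiff1 i k :
  padic_abs p (integ (bt i) ('X^k * divdiff1 K A)) <= k.+1%:R * a ^+ k.+1.
Proof.
have g0 : 0 <= k.+1%:R * a ^+ k.+1 by rewrite mulr_ge0// exprn_ge0// ltW.
rewrite integ_Xn_mul_divdiff1; apply: padic_abs_sum => // s _.
rewrite padic_absM//.
(* For [s <= D] the Gauss bound gives at most [a ^+ (D - s)]; beyond [D] the coefficient is 0. *)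
have A1 : padic_abs p A`_s <= 1.
  have [sD|Ds] := leqP s D; last first.
    by rewrite nth_default ?padic_abs0//; apply: leq_trans size_pade_Xn _.
  have as0 : 0 < a ^+ s by rewrite exprn_gt0.
  rewrite -(ler_pM2r as0) mul1r; apply: le_trans (pade_gauss n hp a0 ha l s) _.
  by rewrite ler_wiXn2l ?(ltW a0)// (le_trans a2)// invf_le1.
apply: le_trans (ler_wpM2r (padic_abs_ge0 hp _) A1) _; rewrite mul1r.
apply: padic_abs_sum => // j _; apply: le_trans (padic_abs_exp_div i _) _.
by apply: mul_expr_nincr => //; [exact: ltW|lia].
Qed.

(** In [integ_geometric] the terms with [j < n] vanish by orthogonality, and the others have
    [D + j >= m.+1 * n]; the truncation term has order [k.+1] in [a]. *)
Lemma padic_abs_remainder i k : (m.+1 * n <= k)%N ->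
  padic_abs p (A.[1] * integ (bt i) (\sum_(j < k) 'X^j) -
               integ (bt i) (divdiff1 K A))
  <= (m.+1 * n).+1%:R * a ^+ (m.+1 * n).+1.
Proof.
move=> nk; have g0 : 0 <= (m.+1 * n).+1%:R * a ^+ (m.+1 * n).+1.
  by rewrite mulr_ge0// exprn_ge0// ltW.
have dec y : (m.+1 * n <= y)%N ->
    y.+1%:R * a ^+ y.+1 <= (m.+1 * n).+1%:R * a ^+ (m.+1 * n).+1.
  by move=> h; apply: mul_expr_nincr => //; exact: ltW.
rewrite integ_geometric.
  apply: le_trans (padic_abs_ultra hp _ _) _; rewrite ge_max; apply/andP; split.
    apply: padic_abs_sum => // j _; have [jn|nj] := ltnP j n.
      by rewrite integ_pade// padic_abs0.
    apply: le_trans (padic_abs_integ_pade i j) (dec _ _).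
    by rewrite /D mulSn; lia.
  rewrite padic_absN; apply: le_trans (padic_abs_integ_divdiff1 i k) (dec _ nk).
by apply: leq_trans size_pade_Xn _; rewrite /D /K; lia.
Qed.

End Padic.

Section Integrality.
Variable Q : nat.
Hypotheses (Q0 : (0 < Q)%N) (hQ : forall i, Q%:R * bt i \is a Num.int).

Let q0 : Q%:R != 0 :> rat. Proof. by rewrite pnatr_eq0 -lt0n. Qed.

Lemma pade_horner1_int : Q%:R ^+ D * A.[1] \is a Num.int.
Proof.
rewrite (horner_coef_wide _ size_pade_Xn) mulr_sumr; apply: rpred_sum => s _.
rewrite expr1n mulr1.
have -> : Q%:R ^+ D * A`_s = A`_s * Q%:R ^+ D / Q%:R ^+ s * Q%:R ^+ s.
  by rewrite divfK ?expf_neq0// mulrC.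
by rewrite rpredM ?rpredX ?natr_int//; exact: pade_int.
Qed.

Lemma pade_integ_int i :
  (lcm_upto D)%:R * Q%:R ^+ D * integ (bt i) (divdiff1 K A) \is a Num.int.
Proof.
rewrite integ_divdiff1 mulr_sumr; apply: rpred_sum => s _.
have [sD|Ds] := leqP s D; last first.
  by rewrite nth_default ?mul0r ?mulr0//; apply: leq_trans size_pade_Xn _.
rewrite !mulr_sumr; apply: rpred_sum => j _.
have js := ltn_ord j.
(* The power [Q ^+ D] is shared out: [D - s] to the coefficient, [j.+1] to the powers of [bt i], and
   [s - j.+1] left over. The lcm clears [j.+1 <= s <= D]. *)
have -> : (lcm_upto D)%:R * Q%:R ^+ D * (A`_s * (bt i ^+ j.+1 / j.+1%:R)) =
  (A`_s * Q%:R ^+ D / Q%:R ^+ s) * (Q%:R * bt i) ^+ j.+1 * Q%:R ^+ (s - j.+1) *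
  ((lcm_upto D)%:R / j.+1%:R).
  rewrite -[in Q%:R ^+ s](subnKC js) exprD exprMn; field.
  by rewrite nat1r pnatr_eq0 !expf_neq0.
apply: rpredM; last by rewrite int_divP// dvdn_lcm_upto//= (leq_trans js).
apply: rpredM; last by rewrite rpredX ?natr_int.
by apply: rpredM; [exact: pade_int|rewrite rpredX ?hQ].
Qed.

End Integrality.

Section Archimedean.
Variable M : rat.
Hypotheses (M1 : 1 < M) (hM : forall i, `|bt i| <= M).

Let M0 : 0 < M. Proof. exact: lt_trans M1. Qed.
Let C := 2 ^+ (l + n) * 3 ^+ (m * n) * M ^+ D.

Lemma pade_horner1_norm : `|A.[1]| <= C.
Proof.
rewrite (horner_coef_wide _ size_pade_Xn); apply: le_trans (ler_norm_sum _ _ _) _.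
apply: le_trans (pade_norm n M1 hM l D.+1); apply: ler_sum => s _.
by rewrite expr1n mulr1 ler_peMr// exprn_ege1// ltW.
Qed.

(** The inner sum is dominated by a geometric one, at most [M ^+ s * (M / (M - 1))]. *)
Lemma pade_integ_norm i : `|integ (bt i) (divdiff1 K A)| <= C * (M / (M - 1)).
Proof.
have M10 : 0 < M - 1 by rewrite subr_gt0.
have MM : 0 <= M / (M - 1) by rewrite divr_ge0 ?ltW.
rewrite integ_divdiff1; apply: le_trans (ler_norm_sum _ _ _) _.
apply: le_trans (ler_wpM2r MM (pade_norm n M1 hM l K)).
rewrite mulr_suml; apply: ler_sum => s _; rewrite normrM -mulrA ler_wpM2l//.
apply: le_trans (ler_norm_sum _ _ _) _.
apply: le_trans (_ : \sum_(j < s) M ^+ j.+1 <= _).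
  apply: ler_sum => j _; rewrite normrM normrX normfV normr_nat.
  rewrite ler_pdivrMr ?ltr0n//; apply: le_trans (_ : M ^+ j.+1 <= _).
    by rewrite lerXn2r ?nnegrE// ltW.
  by rewrite ler_peMr ?exprn_ge0 ?(ltW M0)// ler1n.
have -> : \sum_(j < s) M ^+ j.+1 = M * \sum_(j < s) M ^+ j.
  by rewrite mulr_sumr; apply: eq_bigr => j _; rewrite exprS.
rewrite mulrCA ler_wpM2l ?(ltW M0)// ler_pdivlMr// mulrC -subrX1.
by rewrite gerBl.
Qed.

End Archimedean.

End PadeForms.

(** * A lower bound for the partial sums of the linear form *)

Definition log1p_psum (x : rat) (k : nat) : rat :=
  \sum_(j < k) (-1) ^+ j / j.+1%:R * x ^+ j.+1.

Lemma log1p_psumE x k : log1p_psum x k = - integ (- x) (\sum_(j < k) 'X^j).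
Proof.
rewrite linear_sum -sumrN; apply: eq_bigr => j _; rewrite /= integXn.
by rewrite (exprNn x) (exprS (-1)); ring.
Qed.

(** Truncating all logarithms at the same order keeps the main estimate inside the rationals. *)
Definition lambda_psum (m : nat) (lambda : 'I_m.+1 -> int) (alpha : 'I_m -> rat)
    (k : nat) : rat :=
  (lambda ord0)%:~R +
  \sum_(i < m) (lambda (lift ord0 i))%:~R * log1p_psum (alpha i) k.

(** An upper bound for the integer form, uniform in [l <= m]: [4] comes from the lcm, [m + m * n] is
    the largest degree, and there are [m.+1] terms. *)
Definition pade_height (m n Q : nat) (M H : rat) : rat :=
  m.+1%:R * H * (4 * Q%:R * M) ^+ (m + m * n) * 2 ^+ (m + n) * 3 ^+ (m * n)
  * (M / (M - 1)).

Section LowerBound.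
Variables (p : nat) (hp : prime p) (m n Q : nat) (a M H : rat).
Variables (lambda : 'I_m.+1 -> int) (alpha : 'I_m -> rat).
Hypotheses (a0 : 0 < a) (a2 : a <= 2^-1)
  (ha : forall i, padic_abs p (alpha i) <= a).
Hypotheses (M1 : 1 < M) (hM : forall i, `|alpha i| <= M).
Hypotheses (Q0 : (0 < Q)%N) (hQ : forall i, Q%:R * alpha i \is a Num.int).
Hypotheses (alpha_inj : injective alpha) (alpha_neq0 : forall i, alpha i != 0).
Hypotheses (hH : forall i, `|lambda i|%:~R <= H) (lambda_neq0 : exists i, lambda i != 0).
Hypothesis small : pade_height m n Q M H * ((m.+1 * n).+1%:R * a ^+ (m.+1 * n).+1) < 1.

Let bt i := - alpha i.

Lemma pade_height_gt0 : 0 < pade_height m n Q M H.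
Proof.
have H0 : 0 < H.
  have [i li] := lambda_neq0; apply: lt_le_trans (hH i).
  by rewrite ltr0z normr_gt0.
have M0 : 0 < M by exact: lt_trans M1.
by rewrite /pade_height !mulr_gt0 ?exprn_gt0 ?mulr_gt0 ?ltr0n ?invr_gt0 ?subr_gt0.
Qed.

Lemma lambda_psum_ge k : (m.+1 * n <= k)%N ->
  (pade_height m n Q M H)^-1 <= padic_abs p (lambda_psum lambda alpha k).
Proof.
(* The sign comes from [log1p_psumE]: the logarithm is minus an integral up to [- alpha i]. *)
move=> nk; pose mu i : rat := - (lambda (lift ord0 i))%:~R.
have H0 : 0 <= H by apply: le_trans (hH ord0); rewrite ler0z.
have M0 : 0 < M by exact: lt_trans M1.
have bt_inj : injective bt by move=> i j /oppr_inj /alpha_inj.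
have bt_neq0 i : bt i != 0 by rewrite oppr_eq0.
have hab i : padic_abs p (bt i) <= a by rewrite padic_absN.
have hMb i : `|bt i| <= M by rewrite normrN.
have hQb i : Q%:R * bt i \is a Num.int by rewrite mulrN rpredN.
have mu_neq0 : ((lambda ord0)%:~R != 0 :> rat) || [exists i, mu i != 0].
  have [j lj] := lambda_neq0; case: (unliftP ord0 j) => [i|] Ej.
    by apply/orP; right; apply/existsP; exists i; rewrite oppr_eq0 intr_eq0 -Ej.
  by rewrite intr_eq0 -Ej lj.
have [l] := pade_form_neq0 n bt_inj bt_neq0 mu_neq0.
set A := pade n bt 'X^l; set K := (m.+1 + m * n)%N; set S := _ + _ => S0.
have lm : (l <= m)%N by rewrite -ltnS.
set D := (l + m * n)%N.
pose d : rat := (lcm_upto D)%:R * Q%:R ^+ D.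
have d0 : 0 < d by rewrite mulr_gt0 ?exprn_gt0 ?ltr0n ?lcm_upto_gt0.
have dA : d * A.[1] \is a Num.int.
  by rewrite -mulrA rpredM ?natr_int//; exact: pade_horner1_int.
have dS : d * S \is a Num.int.
  rewrite mulrDr rpredD//; first by rewrite mulrCA rpredM ?intr_int.
  rewrite mulr_sumr rpred_sum// => i _; rewrite mulrCA rpredM ?rpredN ?intr_int//.
  exact: pade_integ_int.
pose C : rat := 2 ^+ (l + n) * 3 ^+ (m * n) * M ^+ D.
have MM : 1 <= M / (M - 1) by rewrite ler_pdivlMr ?subr_gt0// mul1r gerBl.
have C0 : 0 <= C by rewrite !mulr_ge0 ?exprn_ge0 ?(ltW M0).
pose X := H * (C * (M / (M - 1))).
have normS : `|S| <= m.+1%:R * X.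
  apply: le_trans (ler_normD _ _) _; rewrite -nat1r mulrDl mul1r; apply: lerD.
    rewrite normrM -intr_norm ler_pM//; apply: le_trans (pade_horner1_norm _ _ M1 hMb) _.
    by rewrite ler_peMr.
  apply: le_trans (ler_norm_sum _ _ _) _.
  rewrite -[X in X%:R * _]card_ord mulr_natl -sumr_const; apply: ler_sum => i _.
  rewrite normrM normrN -intr_norm ler_pM//.
  exact: pade_integ_norm.
have normdS : `|d * S| <= pade_height m n Q M H.
  rewrite normrM (gtr0_norm d0).
  have D_le : (D <= m + m * n)%N by rewrite leq_add2r.
  have q1 : 1 <= Q%:R :> rat by rewrite ler1n.
  have hd : d <= 4 ^+ (m + m * n) * Q%:R ^+ (m + m * n).
    rewrite ler_pM ?exprn_ge0//; last by rewrite ler_weXn2l.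
    apply: le_trans (_ : 4 ^+ D <= _); last by rewrite ler_weXn2l// ler1n.
    by rewrite -natrX ler_nat lcm_upto_le_exp4.
  have hC : C <= 2 ^+ (m + n) * 3 ^+ (m * n) * M ^+ (m + m * n).
    rewrite ler_pM ?mulr_ge0 ?exprn_ge0 ?(ltW M0)//.
      by rewrite ler_wpM2r ?exprn_ge0// ler_weXn2l ?ler1n// leq_add2r.
    by rewrite ler_weXn2l ?(ltW M1).
  apply: le_trans (ler_pM (ltW d0) (normr_ge0 _) hd normS) _.
  have -> : pade_height m n Q M H = 4 ^+ (m + m * n) * Q%:R ^+ (m + m * n) *
      (m.+1%:R * (H * (2 ^+ (m + n) * 3 ^+ (m * n) * M ^+ (m + m * n) * (M / (M - 1))))).
    by rewrite /pade_height !exprMn; ring.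
  rewrite ler_wpM2l ?mulr_ge0 ?exprn_ge0// ler_wpM2l// ler_wpM2l// ler_wpM2r//.
  by rewrite (le_trans ler01).
have dS0 : d * S != 0 by rewrite mulf_neq0// gt_eqF.
have ge_dS : (pade_height m n Q M H)^-1 <= padic_abs p (d * S).
  apply: le_trans (padic_abs_int_ge hp dS dS0).
  by rewrite lef_pV2 ?posrE ?normr_gt0 ?pade_height_gt0.
set L := lambda_psum lambda alpha k.
(* The [lambda ord0] terms cancel, leaving an integral combination of remainders. *)
have ALS : padic_abs p (A.[1] * L - S) <= (m.+1 * n).+1%:R * a ^+ (m.+1 * n).+1.
  have -> : A.[1] * L - S = \sum_i mu i *
      (A.[1] * integ (bt i) (\sum_(j < k) 'X^j) - integ (bt i) (divdiff1 K A)).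
    rewrite /L /lambda_psum /S mulrDr mulr_sumr mulrC opprD addrACA subrr add0r.
    rewrite -sumrB; apply: eq_bigr => i _; rewrite log1p_psumE -/(bt i) /mu; ring.
  apply: padic_abs_sum => // [|i _]; first by rewrite mulr_ge0// exprn_ge0// ltW.
  rewrite padic_absM// -[leRHS]mul1r ler_pM ?padic_abs_ge0//.
    by rewrite padic_absN padic_abs_int_le1.
  exact: padic_abs_remainder.
(* By the isosceles principle [d * A.[1] * L] then has the same p-adic size as [d * S], and the
   integer [d * A.[1]] can only decrease the size of [L]. *)
have lt_dAL : padic_abs p (d * A.[1] * L - d * S) < padic_abs p (d * S).
  apply: lt_le_trans ge_dS; rewrite -mulrA -mulrBr padic_absM//.
  rewrite -div1r ltr_pdivlMr ?pade_height_gt0// mulrC.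
  apply: le_lt_trans small; rewrite ler_wpM2l ?(ltW pade_height_gt0)//.
  apply: le_trans ALS; rewrite ler_piMl ?padic_abs_ge0//.
  by apply: padic_abs_isint_le1 => //; rewrite /d rpredM ?rpredX ?natr_int.
apply: le_trans ge_dS _; rewrite -(padic_abs_isosceles hp lt_dAL) padic_absM//.
by rewrite ler_piMl ?padic_abs_ge0// padic_abs_isint_le1.
Qed.

End LowerBound.

(** * Passage to the p-adic limit *)

Section QpRat.
Local Open Scope quotient_scope.
Variables (p : nat) (hp : prime p).

Definition cauchy_cst (q : rat) : cauchy_seq hp := CauchySeq (cst_cauchy hp q).

Lemma Qp_ratr0 : ratr 0 = 0 :> Qp hp.
Proof. by apply/eqP; rewrite -Qp_abs_eq0 Qp_abs_ratr padic_abs0. Qed.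

Lemma Qp_ratr1 : ratr 1 = 1 :> Qp hp.
Proof. by rewrite ratr_Qp -Qp_pi1; congr (\pi _); apply: val_inj. Qed.

Lemma Qp_ratrD x y : ratr (x + y) = ratr x + ratr y :> Qp hp.
Proof. by rewrite !ratr_Qp -Qp_piD; congr (\pi _); apply: val_inj. Qed.

Lemma Qp_ratrN x : ratr (- x) = - ratr x :> Qp hp.
Proof. by rewrite !ratr_Qp -Qp_piN; congr (\pi _); apply: val_inj. Qed.

Lemma Qp_ratrM x y : ratr (x * y) = ratr x * ratr y :> Qp hp.
Proof. by rewrite !ratr_Qp -Qp_piM; congr (\pi _); apply: val_inj. Qed.

Lemma Qp_ratrX x n : ratr (x ^+ n) = ratr x ^+ n :> Qp hp.
Proof.
elim: n => [|n IH]; first by rewrite !expr0 Qp_ratr1.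
by rewrite !exprS Qp_ratrM IH.
Qed.

Lemma Qp_ratr_nat n : ratr n%:R = n%:R :> Qp hp.
Proof.
elim: n => [|n IH]; first exact: Qp_ratr0.
by rewrite -!natr1 Qp_ratrD IH Qp_ratr1.
Qed.

Lemma Qp_ratr_int (z : int) : ratr z%:~R = z%:~R :> Qp hp.
Proof.
case: z => n; first exact: Qp_ratr_nat.
by rewrite NegzE !mulrNz Qp_ratrN -[(Posz _)%:~R]/(n.+1%:R) Qp_ratr_nat.
Qed.

Lemma Qp_ratrV x : ratr x^-1 = (ratr x)^-1 :> Qp hp.
Proof.
have [->|x0] := eqVneq x 0; first by rewrite invr0 Qp_ratr0 invr0.
have r0 : ratr x != 0 :> Qp hp.
  by rewrite -Qp_abs_eq0 Qp_abs_ratr padic_abs_eq0.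
by apply: (mulIf r0); rewrite -Qp_ratrM !mulVf// Qp_ratr1.
Qed.

(** From ['C(k.+1, 2) <= 2 ^ k.+1] the left side is at most [2 / k]. *)
Lemma mul_half_exp_lt (e : rat) : 0 < e ->
  exists N, forall k, (N <= k)%N -> k.+1%:R * (2^-1 : rat) ^+ k.+1 < e.
Proof.
move=> e0; have e2 : 0 <= 2 / e by rewrite divr_ge0// ltW.
exists (Num.bound (2 / e)) => k hk.
have ek : 2 < k%:R * e.
  by rewrite -ltr_pdivrMr//; apply: lt_le_trans (archi_boundP e2) _; rewrite ler_nat.
have := mul_bin_diag k.+1 1; rewrite /= bin1 => E.
have : k.+1%:R * k%:R <= 2 * 2 ^+ k.+1 :> rat.
  by rewrite -natrX -!natrM ler_nat E leq_mul2l leq_bin_exp2.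
rewrite exprVn ltr_pdivrMr ?exprn_gt0//.
move: (2 ^+ k.+1) (exprn_gt0 k.+1 (ltr0Sn rat 1)) => t t0 h.
have k0 : 0 < k%:R :> rat by rewrite -(pmulr_lgt0 _ e0) (lt_trans _ ek).
rewrite -(ltr_pM2r k0); apply: le_lt_trans h _.
by rewrite mulrAC -(mulrC k%:R) ltr_pM2r// mulrC.
Qed.

Lemma log1p_psum_cauchy (x : rat) : padic_abs p x < 1 ->
  log1p_psum x \in padic_cauchy hp.
Proof.
move=> /(padic_abs_lt1_le_half hp) x2; apply/asboolP => e e0.
have [N hN] := mul_half_exp_lt e0.
have h i j : (N <= i <= j)%N -> padic_abs p (log1p_psum x j - log1p_psum x i) < e.
  move=> /andP[Ni ij]; rewrite /log1p_psum -(subnKC ij) big_split_ord /=.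
  rewrite addrAC subrr add0r; apply: le_lt_trans (hN i Ni).
  apply: padic_abs_sum => // s _.
  apply: le_trans (_ : (i + s).+1%:R * 2^-1 ^+ (i + s).+1 <= _); last first.
    by apply: mul_expr_nincr => //; lia.
  rewrite !padic_absM// !padic_abs_exp// padic_absN padic_abs1 expr1n mul1r.
  rewrite ler_pM ?padic_abs_Vnat ?padic_abs_ge0 ?exprn_ge0 ?padic_abs_ge0//.
  by rewrite lerXn2r ?nnegrE ?padic_abs_ge0.
exists N => i j Ni Nj; have [ij|/ltnW ji] := leqP i j.
  by rewrite -opprB padic_absN h// Ni.
by rewrite h// Nj.
Qed.

Lemma Qp_log_psum (x : rat) (hx : padic_abs p x < 1) :
  Qp_log (1 + ratr x) = \pi_(Qp hp) (CauchySeq (log1p_psum_cauchy hx)).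
Proof.
rewrite /Qp_log; apply: cvg_lim; first exact: Qp_hausdorff.
rewrite (_ : series _ = (fun k => ratr (log1p_psum x k) : Qp hp)).
  exact: (@Qp_cvg_pi p hp (CauchySeq (log1p_psum_cauchy hx))).
apply/funext => k; rewrite /series /= big_mkord /log1p_psum (big_morph _ Qp_ratrD Qp_ratr0).
apply: eq_bigr => j _; rewrite addrC addKr !Qp_ratrM Qp_ratrV !Qp_ratrX Qp_ratrN.
by rewrite Qp_ratr1 Qp_ratr_nat.
Qed.

Lemma Lambda_p_psum (m : nat) (lambda : 'I_m.+1 -> int) (alpha : 'I_m -> rat) :
  (forall i, padic_abs p (alpha i) < 1) ->
  exists2 u : cauchy_seq hp, Lambda_p hp lambda alpha = \pi_(Qp hp) u &
    forall k, u k = lambda_psum lambda alpha k.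
Proof.
move=> ha; pose u i := CauchySeq (log1p_psum_cauchy (ha i)).
exists (cauchy_cst (lambda ord0)%:~R +
  \sum_(i < m) cauchy_cst (lambda (lift ord0 i))%:~R * u i).
  rewrite Qp_piD (big_morph _ (@Qp_piD _ hp) (_ : \pi 0 = 0)); last first.
    by apply/eqP; rewrite Qp_eq0; apply/asboolP => e e0; exists 0%N => n _; rewrite padic_abs0.
  rewrite -ratr_Qp Qp_ratr_int; congr (_ + _); apply: eq_bigr => i _.
  by rewrite Qp_piM -ratr_Qp Qp_ratr_int Qp_log_psum.
move=> k; rewrite cauchy_valD /lambda_psum; congr (_ + _).
rewrite (big_morph (fun v : cauchy_seq hp => v k) (id1 := 0) (op1 := +%R)) //.
Qed.

(** The bound makes the sequence non-null, so its absolute values are eventually constant. *)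
Lemma Qp_abs_pi_ge (u : cauchy_seq hp) (B : rat) N : 0 < B ->
  (forall k, (N <= k)%N -> B <= padic_abs p (u k)) -> B <= Qp_abs (\pi_(Qp hp) u).
Proof.
move=> B0 hB; have hu : u \notin null_seq (hp:=hp).
  apply/asboolPn => /(_ B B0)[K /(_ (maxn N K) (leq_maxr _ _))].
  by rewrite ltNge hB// leq_maxl.
have [K hK] := Qp_abs_const hu.
by rewrite -(hK (maxn N K)) ?leq_maxr// hB// leq_maxl.
Qed.

End QpRat.

(** * Choice of the order of approximation *)

Section NumericBounds.
Variable R : realType.

(** Applied with exponent 64 or 128, this reduces numerical bounds to rational arithmetic; upper
    bounds on [expR] use the opposite argument. *)
Lemma expR_ge_pow (x : R) n : 0 <= 1 + x / n.+1%:R ->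
  (1 + x / n.+1%:R) ^+ n.+1 <= expR x.
Proof.
move=> h; rewrite -[x in leRHS](divfK (_ : n.+1%:R != 0)) ?pnatr_eq0//.
by rewrite expRM_natr lerXn2r ?nnegrE ?expR_ge0// expR_ge1Dx.
Qed.

Lemma ln2_bounds : 137 / 200 <= ln (2 : R) <= 7 / 10.
Proof.
have ln2E : expR (ln 2) = 2 :> R by rewrite lnK ?posrE.
apply/andP; split; rewrite -ler_expR ln2E.
  rewrite -[137 / 200]opprK expRN -[leRHS]invrK lef_pV2 ?posrE ?expR_gt0//.
  by apply: le_trans (@expR_ge_pow _ 63 _); lra.
by apply: le_trans (@expR_ge_pow _ 63 _); lra.
Qed.

Lemma ln3_ge : 109 / 100 <= ln (3 : R).
Proof.
have ln3E : expR (ln 3) = 3 :> R by rewrite lnK ?posrE.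
rewrite -ler_expR ln3E -[109 / 100]opprK expRN -[leRHS]invrK.
rewrite lef_pV2 ?posrE ?expR_gt0//.
by apply: le_trans (@expR_ge_pow _ 127 _); lra.
Qed.

Lemma kappa_bounds : 103 / 100 <= kappa R <= 26 / 25.
Proof. rewrite /kappa; lra. Qed.

(** The exponent is split at [y = 20]: the constant part gives at least 70, the rest the square of a
    linear function. *)
Lemma quad_lt_expR (y : R) : 20 <= y ->
  27 / 25 * (y ^+ 2 / (54 / 5) + 31 / 25 * y) < expR (11 / 50 * y).
Proof.
move=> y20; have -> : 11 / 50 * y = 22 / 5 + 11 / 100 * (y - 20) * 2%:R by lra.
rewrite expRD expRM_natr.
have e1 : 70 <= expR (22 / 5 : R).
  by apply: le_trans (@expR_ge_pow _ 127 _); lra.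
have e2 : (1 + 11 / 100 * (y - 20)) ^+ 2 <= expR (11 / 100 * (y - 20)) ^+ 2.
  by rewrite lerXn2r ?nnegrE ?expR_ge0 ?expR_ge1Dx//; lra.
have := ler_pM _ (sqr_ge0 _) e1 e2; rewrite ler0n => /(_ isT).
by apply: lt_le_trans; nra.
Qed.

End NumericBounds.

(* Here e = eps/3, h = ln H, L = - ln alpha, X = ln (Q M) and
   mu = ln (M / (M - 1)); then F is ln f, r is R_1 + 1, and S is the logarithm of
   the size of the integer form. *)
Lemma exists_pade_order (R : realType) (m : nat) (e L X mu h : R) :
  let k := kappa R in
  let F := (m%:R + 1) * L - ln 2 - m%:R * ln 3 - k * m%:R - m%:R * X in
  let r := 1 + k * m%:R + m%:R * X + ln (m%:R + 1) + (m%:R - 1) * ln 2 + mu +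
    ln (m%:R + 2) - L - ln F in
  (0 < m)%N -> 0 < e -> e <= 1 -> 0 < L -> L <= X -> 0 <= mu -> 0 < h -> 0 < F ->
  (m%:R + 1) * L <= (m%:R + 1 + e) * F -> 0 <= h + r ->
  m%:R * (ln 2 + ln 3) + ln (m%:R + 1) + 2 * k * m%:R + 2 * m%:R * X + mu +
    ((m%:R + 1) * L / F - 1) * r <= e * h ->
  exists n : nat,
    let S := h + ln (m%:R + 1) + (m%:R + m%:R * n%:R) * (2 * ln 2 + X) +
      (m%:R + n%:R) * ln 2 + m%:R * n%:R * ln 3 + mu in
    S + ln ((m%:R + 1) * n%:R + 1) < ((m%:R + 1) * n%:R + 1) * L /\
    S < (m%:R + 1 + 3 * e) * h.
Proof.
move=> k F r m0 e0 e1 L0 LX mu0 h0 F0 hE hr hz.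
have x1 : 1 <= (m%:R : R) by rewrite ler1n.
have /andP[k1 k2] := kappa_bounds R; rewrite -/k in k1 k2.
have /andP[a1 a2] := ln2_bounds R; have a3 := ln3_ge R.
have FE : F = (m%:R + 1) * L - ln 2 - m%:R * ln 3 - k * m%:R - m%:R * X by [].
have rE : r = 1 + k * m%:R + m%:R * X + ln (m%:R + 1) + (m%:R - 1) * ln 2 + mu +
    ln (m%:R + 2) - L - ln F by [].
clearbody k F r; set x : R := m%:R in x1 hE hz FE rE *.
have lnx0 : ln 2 <= ln (x + 1) by rewrite ler_ln ?posrE; clear -x1; lra.
have lnx1 : ln 3 <= ln (x + 2) by rewrite ler_ln ?posrE; clear -x1; lra.
(* The tangent to [ln] at 32. *)
have lnF : ln F <= F / 32 + 5 * ln 2 - 1.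
  have F32 : 0 < F / 32 by rewrite divr_gt0.
  have : ln (F / 32) <= F / 32 - 1.
    by rewrite -[X in ln X](subrKC 1) le_ln1Dx//; clear -F32; lra.
  rewrite ln_div ?posrE// (_ : 32 = 2 ^+ 5) ?lnXn//; last by clear; ring.
  by rewrite -mulr_natl => hF; clear -hF; lra.
pose D := ln 2 + x * (ln 3 + k).
have DE : D = ln 2 + x * (ln 3 + k) by [].
have D1 : 137 / 200 + 53 / 25 * x <= D by rewrite /D; clear -x1 k1 a1 a3; nra.
clearbody D.
have D0 : 0 < D by clear -x1 D1; lra.
have XL : 0 <= x * (X - L) by apply: mulr_ge0; clear -x1 LX; lra.
have FLD : F <= L - D by clear -FE DE XL; lra.
(* Combining [F <= L - D] with [hE]; since [D] grows like [x], [F] is at least of order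
   [x ^+ 2 / e]. *)
have eF : (x + 1) * D <= e * F.
  have : (x + 1) * (F + D) <= (x + 1) * L by rewrite ler_wpM2l; clear -x1 FLD; lra.
  by clear -hE; lra.
have FD : (x + 1) * D <= F.
  have : e * F <= 1 * F by rewrite ler_wpM2r// ltW.
  by clear -eF; lra.
have r_ge : - (F / 32) <= r.
  have h1 : 0 <= (x - 1) * L by apply: mulr_ge0; clear -x1 L0; lra.
  have h2 : 0 <= (x - 1) * ln 2 by apply: mulr_ge0; clear -x1 a1; lra.
  have h3 : 0 <= (x - 1) * k by apply: mulr_ge0; clear -x1 k1; lra.
  by clear -rE h1 h2 h3 XL lnF lnx0 lnx1 a1 a2 a3 k1 mu0; lra.
pose E := (x + 1) * L / F; rewrite -/E in hz.
have EF : E * F = (x + 1) * L by rewrite /E divfK// gt_eqF.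
have E1 : x + 1 <= E.
  by rewrite /E ler_pdivlMr//; apply: ler_wpM2l; clear -x1 FLD D0; lra.
have E2 : E <= x + 1 + e by rewrite /E ler_pdivrMr.
clearbody E.
set P := x * (ln 2 + ln 3) + ln (x + 1) + 2 * k * x + 2 * x * X + mu in hz.
have PE : P = x * (ln 2 + ln 3) + ln (x + 1) + 2 * k * x + 2 * x * X + mu by [].
clearbody P.
have P1 : x * (383 / 100 + 2 * F + 2 * D) <= P.
  have h1 : x * (F + D) <= x * L by rewrite ler_wpM2l; clear -x1 FLD; lra.
  have h2 : x * (383 / 100) <= x * (ln 2 + ln 3 + 2 * k).
    by rewrite ler_wpM2l; clear -x1 a1 a3 k1; lra.
  by clear -PE h1 h2 XL lnx0 a1 mu0; lra.
have P0 : 0 <= P.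
  by apply: le_trans P1; apply: mulr_ge0; clear -x1 D0 F0; lra.
(* The budget [e * h] becomes [x * y]; the next bounds show that [y] dominates [F], [r + F] and a
   quadratic in [x]. *)
pose y := e * h / x.
have yz : e * h = x * y.
  by rewrite /y mulrCA divff ?mulr1// gt_eqF//; clear -x1; lra.
clearbody y; rewrite yz in hz.
have xp : 0 < x by clear -x1; lra.
have Er : r < 0 -> - (x * F / 16) <= (E - 1) * r.
  move=> r0; have h1 : (E - 1 - 2 * x) * r >= 0.
    by rewrite mulr_le0 ?(ltW r0)//; clear -E2 e1 x1; lra.
  have h2 : x * (- (F / 32)) <= x * r by rewrite ler_wpM2l// ltW.
  by clear -h1 h2; lra.
have Er' : 0 <= r -> x * r <= (E - 1) * r.
  by move=> r0; rewrite ler_wpM2r//; clear -E1; lra.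
have y2 : r + 31 / 16 * F <= y.
  rewrite -(ler_pM2l xp); have xF : 0 <= x * F by rewrite mulr_ge0// ltW.
  have xD : 0 <= x * D by rewrite mulr_ge0// ltW.
  have [r0|r0] := leP 0 r; first by move: (Er' r0); clear -P1 hz xF xD xp; lra.
  have h1 : x * r <= 0 by rewrite mulr_ge0_le0// ltW.
  by move: (Er r0); clear -P1 hz xF xD xp h1; lra.
have y1 : 383 / 100 + 31 / 16 * F + 2 * D <= y.
  rewrite -(ler_pM2l xp); have xF : 0 <= x * F by rewrite mulr_ge0// ltW.
  have [r0|r0] := leP 0 r; last by move: (Er r0); clear -P1 hz xF; lra.
  have h1 : 0 <= x * r by rewrite mulr_ge0// ltW.
  by move: (Er' r0); clear -P1 hz xF h1; lra.
have y3 : 41 / 10 * x ^+ 2 + 48 / 5 * x + 13 / 2 <= y.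
  have h1 : (x + 1) * (137 / 200 + 53 / 25 * x) <= (x + 1) * D.
    by rewrite ler_wpM2l//; clear -xp; lra.
  by clear -h1 y1 D1 FD xp x1; nra.
have y20 : 20 <= y by clear -y3 x1; nra.
(* Since [e * y >= 54 / 5 * x], the relation [e * h = x * y] makes [h] at most quadratic in [y]. *)
have yh : 54 / 5 * h <= y ^+ 2.
  have h1 : 31 / 16 * ((x + 1) * D) <= e * y.
    have : e * (31 / 16 * F) <= e * y.
      by rewrite ler_pM2l//; clear -y1 D0; lra.
    by clear -eF; lra.
  have h2 : 54 / 5 * x <= 31 / 16 * ((x + 1) * D).
    have : (x + 1) * (137 / 200 + 53 / 25 * x) <= (x + 1) * D.
      by rewrite ler_wpM2l//; clear -xp; lra.
    by clear -x1; nra.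
  have : h * (54 / 5 * x) <= x * y ^+ 2.
    apply: le_trans (ler_wpM2l (ltW h0) (le_trans h2 h1)) _.
    by rewrite mulrA (mulrC h) yz expr2 mulrA.
  by move=> h3; rewrite -(ler_pM2l xp); clear -h3; lra.
(* The loss from bounding the lcm by a power of 4; [F'] below is [F] with [k] replaced by
   [2 * ln 2]. *)
pose d := 2 * ln 2 - k; have dE : d = 2 * ln 2 - k by [].
have d0 : 0 < d by clear -dE a1 k2; lra.
have d1 : d <= 37 / 100 by clear -dE a2 k1; lra.
clearbody d.
have md : x * d <= 37 / 100 * x by rewrite mulrC ler_pM2r.
have md0 : 0 <= x * d by rewrite mulr_ge0// ltW.
have mdy : x * d <= y / 50 by have := sqr_ge0 (x - 12 / 11); clear -md y3 x1; lra.
pose F' := F - x * d; have F'E : F' = F - x * d by [].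
clearbody F'.
have FD' : (x + 1) * (137 / 200 + 53 / 25 * x) <= F.
  apply: le_trans FD; rewrite ler_wpM2l//; clear -xp; lra.
have FF' : F <= 27 / 25 * F' by clear -F'E FD' md x1; nra.
have F'0 : 0 < F' by clear -FF' F0; lra.
pose E' := (x + 1) * L / F'.
have EF' : E' * F' = (x + 1) * L by rewrite /E' divfK// gt_eqF.
have EFp : 0 <= E * (F - F').
  by rewrite mulr_ge0//; [clear -E1 xp|clear -F'E md0]; lra.
have E'1 : E <= E'.
  by rewrite /E' ler_pdivlMr// -EF; clear -EFp; lra.
have E'2 : E' <= x + 1 + 5 / 4 * e.
  have h1 : (x + 1 + 5 / 4 * e) * (x * d) <= (x + 9 / 4) * (37 / 100 * x).
    by apply: ler_pM => //; clear -e0 e1 xp; lra.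
  have h2 : (x + 9 / 4) * (37 / 100 * x) <= 1 / 4 * ((x + 1) * (137 / 200 + 53 / 25 * x)).
    by clear -x1; nra.
  have h3 : (x + 1) * (137 / 200 + 53 / 25 * x) <= (x + 1) * D.
    by rewrite ler_wpM2l//; clear -xp; lra.
  rewrite /E' ler_pdivrMr// F'E.
  by clear -h1 h2 h3 eF hE; lra.
have E'3 : E' - 1 <= 29 / 25 * (E - 1).
  have : E' <= 27 / 25 * E.
    rewrite /E' ler_pdivrMr// -EF.
    have : 0 <= E * (27 / 25 * F' - F).
      by rewrite mulr_ge0//; [clear -E1 xp|clear -FF']; lra.
    by clear; lra.
  by clear -E1 x1; lra.
clearbody E'.
(* After substituting [r], the first claim asks that [n * F'] exceed [h + r + x * d + ln 2 - 1] plus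
   [ln F - ln (x + 2) + ln ((x + 1) * n + 1)]; the last three terms are bounded by [11 / 50 * y] in
   [lnn]. *)
pose W := h + r + x * d + ln 2 - 1 + 11 / 50 * y.
have WE : W = h + r + x * d + ln 2 - 1 + 11 / 50 * y by [].
clearbody W.
have W0 : 0 <= W by clear -WE hr md0 a1 y20; lra.
have Wq : 27 / 25 * W + 2 * F < expR (11 / 50 * y).
  apply: le_lt_trans (quad_lt_expR y20).
  have : h <= y ^+ 2 / (54 / 5) by rewrite ler_pdivlMr//; clear -yh; lra.
  by clear -WE mdy y2 a2 F0; lra.
(* The least [n] with [W < n * F']; minimality keeps [S] small for the second claim. *)
pose n := (Num.truncn (W / F')).+1.
have WF0 : 0 <= W / F' by rewrite divr_ge0// ltW.
have n1 : W < n%:R * F'.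
  by rewrite -ltr_pdivrMr// /n; have /andP[] := truncn_itv WF0.
have n2 : (n%:R - 1) * F' <= W.
  by rewrite -ler_pdivlMr// /n -natr1 addrK; have /andP[] := truncn_itv WF0.
have n0 : 1 <= n%:R :> R by rewrite ler1n.
clearbody n; set N : R := n%:R in n0 n1 n2 *.
have Fn : F * (N + 1) < expR (11 / 50 * y).
  have : 0 <= (N - 1) * (27 / 25 * F' - F).
    by rewrite mulr_ge0//; [clear -n0|clear -FF']; lra.
  by clear -Wq n2; lra.
have xN : 0 <= x * N by rewrite mulr_ge0.
have lnn : ln ((x + 1) * N + 1) < 11 / 50 * y - ln F + ln (x + 2).
  have n3 : 0 < (x + 1) * N + 1 by clear -xN n0; lra.
  have x2 : 0 < x + 2 by clear -xp; lra.
  rewrite -ltr_expR lnK ?posrE// !expRD expRN !lnK ?posrE//.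
  rewrite mulrAC ltr_pdivlMr//.
  apply: le_lt_trans (_ : (F * (N + 1)) * (x + 2) < _).
    by rewrite mulrC -mulrA ler_pM2l//; clear -xN n0 xp; lra.
  by rewrite ltr_pM2r.
exists n; rewrite -/N; split.
  have -> : h + ln (x + 1) + (x + x * N) * (2 * ln 2 + X) +
      (x + N) * ln 2 + x * N * ln 3 + mu =
    h + ln (x + 1) + x * (2 * ln 2 + X) + x * ln 2 + mu + N * ((x + 1) * L - F').
    by rewrite F'E FE dE; clear; ring.
  by move: WE; rewrite rE dE => WE; clear -WE lnn n1; lra.
have -> : h + ln (x + 1) + (x + x * N) * (2 * ln 2 + X) +
    (x + N) * ln 2 + x * N * ln 3 + mu =
  h + P + 2 * (x * d) + ln 2 + (N - 1) * ((x + 1) * L - F').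
  by rewrite PE F'E FE dE; clear; ring.
have nE : (N - 1) * ((x + 1) * L - F') <= (E' - 1) * W.
  have -> : (N - 1) * ((x + 1) * L - F') = (E' - 1) * ((N - 1) * F').
    by rewrite -EF'; clear; ring.
  by rewrite ler_wpM2l//; clear -E'1 E1 xp; lra.
have rP : P + (E' - 1) * r <= 29 / 25 * (x * y).
  have [r0|r0] := leP 0 r.
    have : (E' - 1) * r <= 29 / 25 * (E - 1) * r by rewrite ler_wpM2r.
    by clear -hz P0; lra.
  have h1 : 0 <= (E - E') * r by rewrite mulr_le0 ?(ltW r0)//; clear -E'1; lra.
  have h2 : 0 <= x * y by rewrite -yz mulr_ge0// ltW.
  by clear -h1 h2 hz; lra.
have hE' : (E' - 1) * h <= (x + 5 / 4 * e) * h.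
  by rewrite ler_wpM2r ?(ltW h0)//; clear -E'2; lra.
have tE : (E' - 1) * (x * d + ln 2 - 1 + 11 / 50 * y) <=
    (x + 5 / 4) * (37 / 100 * x - 3 / 10 + 11 / 50 * y).
  by apply: ler_pM; [clear -E'1 E1 xp|clear -md0 a1 y20|clear -E'2 e1|clear -md a2]; lra.
have fin : 37 / 50 * x + 7 / 10 + (x + 5 / 4) * (37 / 100 * x - 3 / 10 + 11 / 50 * y)
    < 59 / 100 * (x * y).
  have : 0 <= (x - 1) * (y - 41 / 10 * x ^+ 2 - 48 / 5 * x - 13 / 2).
    by rewrite mulr_ge0//; [clear -x1|clear -y3]; lra.
  by clear -y3 x1; nra.
(* The excess over [(x + 1) * h] is at most [5/4] from [hE'], [29/25] from [rP] and [59/100] from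
   [fin], in units of [e * h]: exactly 3 in total. *)
apply: le_lt_trans (_ : h + P + 2 * (x * d) + ln 2 + (E' - 1) * W < _).
  by clear -nE; lra.
have -> : (E' - 1) * W = (E' - 1) * h + (E' - 1) * r +
    (E' - 1) * (x * d + ln 2 - 1 + 11 / 50 * y) by rewrite WE; clear; ring.
by clear -fin tE hE' rP md a2 yz; lra.
Qed.

(** * Logarithms of the given quantities, and the conclusion *)

Section Assembly.
Variable R : realType.

Lemma ratr_bigmax (I : finType) (g : I -> rat) :
  \big[Num.max/0]_i (ratr (g i) : R) = ratr (\big[Num.max/0]_i g i).
Proof.
rewrite (big_morph ratr (op1 := Num.max) (id1 := 0)) ?rmorph0// => x y.
by rewrite !maxEle ler_rat; case: ifP.
Qed.

Lemma ln_exprn (x : R) n : 0 < x -> ln (x ^+ n) = n%:R * ln x.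
Proof. by move=> x0; rewrite lnXn// mulr_natl. Qed.

Lemma ln_f (m : nat) (M Q a : R) : 0 < M -> 0 < Q -> 0 < a ->
  ln (f m M Q a) = (m%:R + 1) * (- ln a) - ln 2 - m%:R * ln 3 - kappa R * m%:R -
    m%:R * (ln Q + ln M).
Proof.
move=> M0 Q0 a0; have p3 : 0 < 3 ^+ m :> R by rewrite exprn_gt0.
have [pM pQ pa] : [/\ 0 < M ^+ m, 0 < Q ^+ m & 0 < a ^+ m.+1] by rewrite !exprn_gt0.
rewrite /f !lnM ?posrE ?mulr_gt0 ?invr_gt0 ?expR_gt0// !lnV ?posrE// expRK.
by rewrite !ln_exprn// -[in m.+1%:R]natr1; ring.
Qed.

(** This turns the lower bound on [H] by a power of [c1] into the last hypothesis of
    [exists_pade_order]. *)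
Lemma ln_c1 (m : nat) (M Q a : R) : 1 < M -> 0 < Q ->
  - ln (c1 m M Q a) = m%:R * (ln 2 + ln 3) + ln (m%:R + 1) + 2 * kappa R * m%:R +
    2 * m%:R * (ln Q + ln M) + (ln M - ln (M - 1)) +
    (- ((m%:R + 1) * ln a / ln (f m M Q a)) - 1) * (R1 m M Q a + 1).
Proof.
move=> M1 Q0; have M0 : 0 < M by exact: lt_trans M1.
have M10 : 0 < M - 1 by rewrite subr_gt0.
have m1 : 0 < m%:R + 1 :> R by rewrite natr1 ltr0n.
have p6 : 0 < 6 ^+ m :> R by rewrite exprn_gt0.
have [pM pQ] : 0 < M ^+ (2 * m).+1 /\ 0 < Q ^+ (2 * m) by rewrite !exprn_gt0.
rewrite /c1; move: (ln (f m M Q a)) (R1 m M Q a) => u v.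
rewrite lnM ?posrE ?expR_gt0 ?divr_gt0 ?mulr_gt0 ?expR_gt0// expRK.
rewrite ln_div ?posrE ?mulr_gt0 ?expR_gt0// !lnM ?posrE ?mulr_gt0 ?expR_gt0//.
rewrite !ln_exprn// expRK (_ : 6 = 2 * 3); last by ring.
rewrite lnM ?posrE// -[in (2 * m).+1%:R]natr1 natrM.
have -> : kappa R = 103883%:R / 100000%:R by [].
have -> : 207766%:R = 2 * 103883%:R :> R.
  by rewrite -natrM; congr (_%:R); apply/eqP; vm_compute.
by ring.
Qed.

Lemma ln_pade_height (m n Q : nat) (M H : rat) : (0 < Q)%N -> 1 < M -> 0 < H ->
  ln (ratr (pade_height m n Q M H) : R) =
  ln (ratr H) + ln (m%:R + 1) +
  (m%:R + m%:R * n%:R) * (2 * ln 2 + (ln Q%:R + ln (ratr M))) +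
  (m%:R + n%:R) * ln 2 + m%:R * n%:R * ln 3 + (ln (ratr M) - ln (ratr M - 1)).
Proof.
move=> Q0 M1 H0.
have M1' : 1 < ratr M :> R by rewrite -(rmorph1 (@ratr R)) ltr_rat.
have H0' : 0 < ratr H :> R by rewrite ltr0q.
have q0 : 0 < Q%:R :> R by rewrite ltr0n.
rewrite /pade_height !(rmorphM, rmorphXn, rmorph_nat, fmorphV, rmorphB, rmorph1) /=.
move: (ratr M) (ratr H) M1' H0' => {M1 H0}M {}H M1 H0.
have M0 : 0 < M by exact: lt_trans M1.
have M10 : 0 < M - 1 by rewrite subr_gt0.
have p4 : 0 < 4 * Q%:R * M by rewrite !mulr_gt0.
rewrite !lnM ?posrE ?mulr_gt0 ?exprn_gt0 ?invr_gt0// lnV ?posrE//.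
rewrite !ln_exprn// !lnM ?posrE ?mulr_gt0// (_ : 4 = 2 * 2); last by ring.
by rewrite lnM ?posrE// !natrD !natrM natr1; ring.
Qed.

End Assembly.

Theorem corollary2p3 (R : realType) (eps : R) (p : nat) (hp : prime p)
    (m : nat) (lambda : 'I_m.+1 -> int) (alpha : 'I_m -> rat) (Q : nat) :
  let M : R := max_abs R alpha in
  let a : R := max_padic_abs R p alpha in
  let H : R := max_coef R lambda in
  let q : R := Q%:R in
  0 < eps -> eps <= 3 ->
  (1 <= m)%N ->
  (exists i, lambda i != 0) ->
  injective alpha ->
  (forall i, alpha i != 0) ->
  (0 < Q)%N ->
  (forall i, Q%:R * alpha i \is a Num.int) ->
  1 < M -> a < 1 -> 1 < H -> 1 < f m M q a ->
  - (1 / (expR (R1 m M q a) * H)) =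
    - ln (f m M q a) /
      (2 ^+ m.-1 * expR (kappa R * m%:R) * q ^+ m * H
       * (M ^+ m.+1 / (M - 1)) * ((m%:R + 1) * (m%:R + 2) * a)) ->
  - ln (f m M q a) /
      (2 ^+ m.-1 * expR (kappa R * m%:R) * q ^+ m * H
       * (M ^+ m.+1 / (M - 1)) * ((m%:R + 1) * (m%:R + 2) * a))
    >= - (1 / expR 1) ->
  (m%:R + 1) * ln a / ln (f m M q a) >= - m%:R - 1 - eps / 3 ->
  H >= Num.max
    (c1 m M q a `^ (- 3 / eps))
    (1 / 2 * expR (- (3 * m%:R / eps + 1) *
       lambertWm1 (- (2 `^ (- eps / (3 * m%:R + eps)))
                   * (eps / (3 * m%:R + eps))))) ->
  ratr (Qp_abs (Lambda_p hp lambda alpha)) > H `^ (- m%:R - 1 - eps).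
Proof.
move=> M a H q eps0 eps3 m0 lambda_neq0 alpha_inj alpha_neq0 Q0 hQ.
(* Rational versions of [M], [a] and [H], since the Pade estimates are over the rationals. *)
pose Mr := \big[Num.max/0]_i `|alpha i|.
pose ar := \big[Num.max/0]_i padic_abs p (alpha i).
pose Hr : rat := \big[Num.max/0]_i `|lambda i|%:~R.
have ME : M = ratr Mr by rewrite /M /max_abs ratr_bigmax.
have aE : a = ratr ar by rewrite /a /max_padic_abs ratr_bigmax.
have HE : H = ratr Hr.
  by rewrite /H /max_coef -ratr_bigmax; apply: eq_bigr => i _; rewrite ratr_int.
have hM i : `|alpha i| <= Mr by apply: le_bigmax.
have ha i : padic_abs p (alpha i) <= ar by exact: le_bigmax.
have hH i : `|lambda i|%:~R <= Hr by exact: le_bigmax.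
have ar0 : 0 < ar.
  exact: lt_le_trans (padic_abs_gt0 hp (alpha_neq0 (Ordinal m0))) (ha _).
have q0 : 0 < q by rewrite ltr0n.
have a0 : 0 < a by rewrite aE ltr0q.
move=> M1 a1 H1 f1 eqR1 geR1 hE.
rewrite -eqR1 in geR1; clear eqR1.
rewrite ge_max => /andP[hc1 _].
have M0 : 0 < M by exact: lt_trans M1.
have H0 : 0 < H by exact: lt_trans H1.
have Mr1 : 1 < Mr by rewrite -(ltr_rat R) rmorph1 -ME.
have Hr0 : 0 < Hr by rewrite -(ltr_rat R) rmorph0 -HE.
have ar1 : ar < 1 by rewrite -(ltr_rat R) rmorph1 -aE.
have ar2 : ar <= 2^-1.
  apply: bigmax_le => // i _; apply: padic_abs_lt1_le_half => //.
  exact: le_lt_trans ar1.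
(* For a nonzero integer [Q * alpha i], the product of its usual and p-adic absolute values is at
   least 1. In logarithms this is [L <= X]. *)
have QMa : 1 <= q * M * a.
  pose x := Q%:R * alpha (Ordinal m0).
  have x0 : x != 0 by rewrite mulf_neq0// pnatr_eq0 -lt0n.
  have hx := padic_abs_int_ge hp (hQ (Ordinal m0)) x0.
  have : 1 <= Q%:R * Mr * ar.
    rewrite -[leLHS](mulfV (_ : `|x| != 0)) ?normr_eq0//; apply: ler_pM => //.
      by rewrite /x normrM normr_nat ler_wpM2l.
    apply: le_trans hx _; apply: le_trans (ha (Ordinal m0)); rewrite /x padic_absM//.
    by rewrite ler_piMl ?padic_abs_ge0// padic_abs_isint_le1// natr_int.
  by rewrite -(ler_rat R) !rmorphM rmorph1 /= rmorph_nat -ME -aE.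
pose e := eps / 3; pose h := ln H; pose L := - ln a; pose X := ln q + ln M.
pose mu := ln M - ln (M - 1).
have FE := ln_f m M0 q0 a0; rewrite -/L -/X in FE.
have F0 : 0 < ln (f m M q a) by rewrite ln_gt0.
have h0 : 0 < h by rewrite ln_gt0.
have L0 : 0 < L by rewrite oppr_gt0 ln_lt0// a0.
have LX : L <= X.
  by rewrite /L /X -subr_ge0 opprK -!lnM ?posrE ?mulr_gt0// ln_ge0.
have mu0 : 0 <= mu by rewrite subr_ge0 ler_ln ?posrE ?subr_gt0// gerBl.
have e0 : 0 < e by rewrite divr_gt0.
have e1 : e <= 1 by rewrite /e ler_pdivrMr// mul1r.
have rE : R1 m M q a + 1 = 1 + kappa R * m%:R + m%:R * X + ln (m%:R + 1) +
    (m%:R - 1) * ln 2 + mu + ln (m%:R + 2) - L - ln (ln (f m M q a)).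
  by rewrite /R1 /X /L /mu; ring.
have hr : 0 <= h + (R1 m M q a + 1).
  move: geR1; rewrite lerN2 !div1r lef_pV2 ?posrE ?mulr_gt0 ?expR_gt0//.
  rewrite -[H]lnK ?posrE// -expRD ler_expR -/h; lra.
have hz : m%:R * (ln 2 + ln 3) + ln (m%:R + 1) + 2 * kappa R * m%:R +
    2 * m%:R * X + mu + ((m%:R + 1) * L / ln (f m M q a) - 1) * (R1 m M q a + 1)
    <= e * h.
  have c10 : 0 < c1 m M q a.
    by rewrite /c1 !(mulr_gt0, expR_gt0, invr_gt0, exprn_gt0) ?subr_gt0// natr1 ltr0n.
  have := ln_c1 m a M1 q0; rewrite -/X -/mu.
  have -> : - ((m%:R + 1) * ln a / ln (f m M q a)) = (m%:R + 1) * L / ln (f m M q a).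
    by rewrite /L; ring.
  move=> <-; rewrite mulrC -ler_pdivrMr//.
  have := hc1; rewrite -ler_ln ?posrE ?powR_gt0// ln_powR -/h.
  by congr (_ <= _); rewrite /e; field; rewrite gt_eqF.
have hEF : (m%:R + 1) * L <= (m%:R + 1 + e) * ln (f m M q a).
  by move: hE; rewrite ler_pdivlMr// /L /e; lra.
rewrite rE in hr hz; rewrite FE in F0 hr hz hEF.
have [n [S1 S2]] := exists_pade_order m0 e0 e1 L0 LX mu0 h0 F0 hEF hr hz.
have SE := ln_pade_height R m n Q0 Mr1 Hr0; rewrite -ME -HE -/h -/mu -/X in SE.
rewrite -SE in S1 S2.
have B0 : 0 < pade_height m n Q Mr Hr by exact: pade_height_gt0.
have B0' : 0 < ratr (pade_height m n Q Mr Hr) :> R by rewrite ltr0q.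
have small : pade_height m n Q Mr Hr *
    ((m.+1 * n).+1%:R * ar ^+ (m.+1 * n).+1) < 1.
  rewrite -(ltr_rat R) (rmorphM _ (pade_height _ _ _ _ _)) (rmorphM _ _%:R) rmorphXn.
  rewrite rmorph1 /= rmorph_nat -aE.
  move: (ratr (pade_height m n Q Mr Hr)) B0' S1 => B B0' S1.
  have y0 : 0 < (m.+1 * n).+1%:R :> R by rewrite ltr0n.
  rewrite -ltr_ln ?posrE ?mulr_gt0 ?exprn_gt0// ln1 lnM ?posrE ?mulr_gt0 ?exprn_gt0//.
  rewrite lnM ?posrE ?exprn_gt0// ln_exprn//.
  have -> : (m.+1 * n).+1%:R = (m%:R + 1) * n%:R + 1 :> R by rewrite -natr1 natrM -natr1.
  by rewrite /L in S1; lra.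
have ha1 i : padic_abs p (alpha i) < 1 by exact: le_lt_trans ar1.
have [u -> uE] := Lambda_p_psum hp lambda ha1.
have : (pade_height m n Q Mr Hr)^-1 <= Qp_abs (\pi_(Qp hp) u)%qT.
  apply: (@Qp_abs_pi_ge _ _ _ _ (m.+1 * n)); first by rewrite invr_gt0.
  by move=> k nk; rewrite uE; exact: (@lambda_psum_ge p hp m n Q ar).
rewrite -(ler_rat R) fmorphV; apply: lt_le_trans.
(* After taking logarithms this is [S2], because [3 * e = eps]. *)
rewrite /powR gt_eqF// -[ltRHS]lnK ?posrE ?invr_gt0// ltr_expR lnV ?posrE//.
by move: S2; rewrite /e -/h; lra.
Qed.
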